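(* Let $\mathbb{L}\in\{\mathbb{R},\mathbb{C}\}$, $n,k\ge1$, and let $\mathbf{P}^{(k)}=[\mathbf{p}_1\cdots\mathbf{p}_k]\in\mathbb{L}^{n\times k}$ be a random matrix whose columns $\mathbf{p}_1,\dots,\mathbf{p}_k$ are independent and uniformly distributed unit vectors in $\mathbb{L}^n$ (i.e., $\mathbf{P}^{(k)}$ is uniformly distributed in $\mathcal{M}^{(k)}_{n,1}(\mathbb{L})$). Let $\mathbf{H}\in\mathbb{L}^{n\times k}$ have i.i.d. Gaussian entries with zero mean and unit variance. Then for any constant $c>0$, \[ \mathrm{E}_{\mathbf{H}}\left[\log\left|\mathbf{I}_k+\frac{c}{n}\mathbf{H}^{\dagger}\mathbf{H}\right|\right]\le \mathrm{E}\left[\log\left|\mathbf{I}_k+c\,\mathbf{P}^{(k)\dagger}\mathbf{P}^{(k)}\right|\right]\le \log\mathrm{E}\left[\left|\mathbf{I}_k+c\,\mathbf{P}^{(k)\dagger}\mathbf{P}^{(k)}\right|\right]. \]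
   Context: $|\cdot|$ denotes the determinant. $\mathcal{M}^{(k)}_{n,1}(\mathbb{L})$ is the set of $n\times k$ matrices whose columns are unit vectors in $\mathbb{L}^n$ (composite Grassmann matrices generating elements of the $k$-fold product of the Grassmann manifold of lines in $\mathbb{L}^n$); ''uniformly distributed'' means the columns are independent and each is uniformly distributed on the unit sphere of $\mathbb{L}^n$. *)

(* Defs.v *)
From HB Require Import structures.
From mathcomp Require Import all_boot all_order all_algebra.
From mathcomp Require Import all_classical all_reals all_analysis.
From mathcomp Require Import complex.
Unset Printing Implicit Defensive.
Import Order.TTheory GRing.Theory Num.Theory.
Local Open Scope ring_scope.

Section Defs.
Context {R : realType}.

(* number of real coordinates per scalar: 1 for L = R, 2 for L = C *)
Definition rdim (cplx : bool) : nat := if cplx then 2 else 1.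

Definition scons (x : R) (s : nat -> R) : nat -> R :=
  fun i => if i is j.+1 then s j else x.

(* Iterated Lebesgue integral over R^N of a function of the first N
   coordinates of s (variables s 0, ..., s (N-1)); extended-real valued. *)
Fixpoint ilint (N : nat) (f : (nat -> R) -> \bar R) : \bar R :=
  match N with
  | 0 => f (fun _ => 0)
  | N'.+1 => (\int[@lebesgue_measure R]_(x in [set: R])
                 ilint N' (fun s => f (scons x s)))%E
  end.

(* Matrix in L^{n x k} built from real coordinates s: entry (i,j) uses
   coordinates starting at rdim*(n*j+i) (column-major blocks). Entries
   live in C = R[i]; in the real case they are real. *)
Definition coord_mx (cplx : bool) (n k : nat) (s : nat -> R) : 'M[R[i]]_(n, k) :=
  \matrix_(i < n, j < k)
    let a := (rdim cplx * (n * j + i))%N in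
    if cplx then Complex (s a) (s a.+1) else Complex (s a) 0.

Definition col_norm (cplx : bool) (n : nat) (s : nat -> R) (j : nat) : R :=
  Num.sqrt (\sum_(t < rdim cplx * n) s (rdim cplx * n * j + t)%N ^+ 2).

Definition unit_col_mx (cplx : bool) (n k : nat) (s : nat -> R) : 'M[R[i]]_(n, k) :=
  \matrix_(i < n, j < k) (coord_mx cplx n k s i j / (col_norm cplx n s j)%:C)%C.

Definition adjmx (m p : nat) (A : 'M[R[i]]_(m, p)) : 'M[R[i]]_(p, m) :=
  (map_mx Num.conj A)^T.

Definition gauss_dens (v x : R) : R :=
  expR (- (x ^+ 2) / (2 * v)) / Num.sqrt (2 * pi * v).

(* Expectation over H in L^{n x k} with i.i.d. zero-mean unit-variance
   (circularly-symmetric, in the complex case) Gaussian entries: each real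
   coordinate is N(0, 1/rdim). *)
Definition gauss_expect (cplx : bool) (n k : nat)
    (f : 'M[R[i]]_(n, k) -> R) : \bar R :=
  ilint (rdim cplx * n * k)
    (fun s => ((\prod_(t < rdim cplx * n * k)
                 gauss_dens (rdim cplx)%:R^-1 (s t)) * f (coord_mx cplx n k s))%:E).

Definition ball_vol (N : nat) : \bar R :=
  ilint N (fun s => (if Num.sqrt (\sum_(t < N) s t ^+ 2) <= 1 then 1 else 0)%:E).

(* Expectation over P = [p_1 ... p_k] with columns i.i.d. uniformly
   distributed on the unit sphere of L^n ~ R^(rdim*n), w.r.t. the normalized
   surface (= cone) measure: E[f(P)] = vol(B)^-k * int_{B^k} f(x_1/|x_1|,...). *)
Definition sphere_expect (cplx : bool) (n k : nat)
    (f : 'M[R[i]]_(n, k) -> R) : \bar R :=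
  ilint (rdim cplx * n * k)
    (fun s => ((\prod_(j < k)
                 ((if col_norm cplx n s j <= 1 then 1 else 0)
                    / fine (ball_vol (rdim cplx * n))))
               * f (unit_col_mx cplx n k s))%:E).

(* log |I_k + A| for a Hermitian A with real positive determinant *)
Definition logdet (k : nat) (A : 'M[R[i]]_k) : R := ln (complex.Re (\det A)).
Definition redet (k : nat) (A : 'M[R[i]]_k) : R := complex.Re (\det A).

End Defs.

(* Main.v *)
(* Write a Gaussian column as h = |h| u. Its direction u is uniform on the sphere and
   independent of |h|, and E |h|^2 = n. With the other columns fixed, the determinant
   |I + (c/n) H^* H| is an affine function of |h|^2 with coefficients depending only on
   u, so its logarithm is concave in |h|^2, and Jensen's inequality lets one replace
   |h|^2 by n. Doing this for one column after the other gives the first inequality.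
   The second one is Jensen's inequality for ln. All integrands are nonnegative because
   the determinants are at least 1, so only Tonelli's theorem is needed. *)
Require Import Defs.
From HB Require Import structures.
From mathcomp Require Import all_boot all_order all_algebra.
From mathcomp Require Import all_classical all_reals all_analysis.
From mathcomp Require Import complex.
From mathcomp Require Import measurable_realfun.
From mathcomp Require Import ring lra zify.
Import Order.TTheory GRing.Theory Num.Theory.
Local Open Scope ring_scope.

Set Implicit Arguments.
Unset Strict Implicit.

(** * Iterated Lebesgue integrals *)

(** Independence of radius and direction is obtained without polar coordinates and without a surface
    measure. The sphere is represented by the normalised unit ball followed by radial projection, so
    everything happens in iterated one-dimensional integrals, and the only change of variables is a
    dilation. For a radial weight times a function [q] homogeneous of degree 0, dilations and
    Tonelli swaps exchange one radial weight for another up to a factor independent of [q]; the case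
    [q = 1] identifies that factor. Both uses of Jensen's inequality go through a tangent line of
    [ln]. To keep every integrand nonnegative, the negative term of each tangent inequality is moved
    to the other side, and a finite quantity is cancelled after integration. The column argument
    sees the determinant only as a function that is at least 1 and affine in the squared norm of
    each column with nonnegative slope. The sign of the slope itself follows from the lower bound
    1. *)

Section IteratedIntegral.
Context {R : realType}.
Implicit Types (N M : nat).
Local Notation mu := (@lebesgue_measure R).

(* Joint measurability, phrased as stability under substitution of measurable
   functions for the coordinates: no sigma-algebra on [nat -> R] is needed. *)
Definition cmeas (f : (nat -> R) -> \bar R) : Prop :=
  forall d (T : measurableType d) (X : nat -> T -> R),
    (forall i, measurable_fun setT (X i)) ->
    measurable_fun setT (fun t => f (fun i => X i t)).

Definition pmeas d0 (P : measurableType d0) (g : P -> (nat -> R) -> \bar R) : Prop :=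
  forall d (T : measurableType d) (h : T -> P) (X : nat -> T -> R),
    measurable_fun setT h -> (forall i, measurable_fun setT (X i)) ->
    measurable_fun setT (fun t => g (h t) (fun i => X i t)).

Definition cmeas2 (f : (nat -> R) -> (nat -> R) -> \bar R) : Prop :=
  forall d (T : measurableType d) (X Y : nat -> T -> R),
    (forall i, measurable_fun setT (X i)) ->
    (forall i, measurable_fun setT (Y i)) ->
    measurable_fun setT (fun t => f (fun i => X i t) (fun i => Y i t)).

Lemma measurable_scons d (T : measurableType d) (x : T -> R) (X : nat -> T -> R) :
  measurable_fun setT x -> (forall i, measurable_fun setT (X i)) ->
  forall i, measurable_fun setT (fun t => scons (x t) (fun j => X j t) i).
Proof. by move=> mx mX [|i]; [exact: mx|exact: mX]. Qed.

Lemma pmeas_scons (f : (nat -> R) -> \bar R) : cmeas f ->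
  pmeas (fun (x : measurableTypeR R) s => f (scons x s)).
Proof.
move=> mf d T h X mh mX.
exact: (mf _ _ (fun i t => scons (h t) (fun j => X j t) i) (measurable_scons mh mX)).
Qed.

Lemma cmeas_scons (f : (nat -> R) -> \bar R) x : cmeas f ->
  cmeas (fun s => f (scons x s)).
Proof.
move=> mf d T X mX.
by apply: (mf _ _ (fun i t => scons x (fun j => X j t) i)); exact: measurable_scons.
Qed.

Lemma ilint_ge0 N (f : (nat -> R) -> \bar R) :
  (forall s, (0 <= f s)%E) -> (0 <= ilint N f)%E.
Proof.
elim: N f => [|N IH] f f0 //=.
by apply: integral_ge0 => x _; apply: IH.
Qed.

(** The space [P] is generalised in the induction: the first coordinate is moved into the parameter
    space, which becomes [P * R], and Tonelli's theorem there gives measurability of the partial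
    integral. *)
Lemma pmeas_ilint N d0 (P : measurableType d0) (g : P -> (nat -> R) -> \bar R) :
  pmeas g -> (forall p s, (0 <= g p s)%E) ->
  measurable_fun setT (fun p => ilint N (g p)).
Proof.
elim: N d0 P g => [|N IH] d0 P g mg g0 /=.
  by apply: (mg _ _ id) => // i; exact: measurable_cst.
pose g' (z : P * measurableTypeR R) s := g z.1 (scons z.2 s).
apply: (@measurable_fun_fubini_tonelli_F _ _ P (measurableTypeR R) R mu
   (fun z => ilint N (g' z))).
- apply: IH => [|z s]; last exact: g0.
  move=> d T h X mh mX; apply: (mg _ _ (fst \o h)
    (fun i t => scons (h t).2 (fun j => X j t) i)).
    exact: measurableT_comp.
  by apply: measurable_scons => //; exact: measurableT_comp.
- by move=> z; apply: ilint_ge0 => s; exact: g0.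
Qed.

Lemma measurable_ilint_scons N (f : (nat -> R) -> \bar R) : cmeas f ->
  (forall s, (0 <= f s)%E) ->
  measurable_fun setT (fun x : measurableTypeR R => ilint N (fun s => f (scons x s))).
Proof. by move=> mf f0; apply: pmeas_ilint => //; exact: pmeas_scons. Qed.

Lemma cmeas_ilint N (f : (nat -> R) -> (nat -> R) -> \bar R) : cmeas2 f ->
  (forall s t, (0 <= f s t)%E) -> cmeas (fun s => ilint N (f s)).
Proof.
move=> mf f0 d T X mX.
apply: (@pmeas_ilint N _ T (fun t s => f (fun i => X i t) s)) => //.
move=> d' T' h Y mh mY; apply: (mf _ _ (fun i => X i \o h)) => // i.
exact: measurableT_comp.
Qed.

(* [ilint N] only sees arguments that vanish from index [N] on. *)
Lemma eq_ilint N (f g : (nat -> R) -> \bar R) :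
  (forall s, (forall i, (N <= i)%N -> s i = 0) -> f s = g s) ->
  ilint N f = ilint N g.
Proof.
elim: N f g => [|N IH] f g fg /=; first by apply: fg.
apply: eq_integral => x _; apply: IH => s s0; apply: fg => -[|i] //= iN.
exact: s0.
Qed.

Lemma le_ilint N (f g : (nat -> R) -> \bar R) : cmeas f -> cmeas g ->
  (forall s, (0 <= f s)%E) -> (forall s, (f s <= g s)%E) ->
  (ilint N f <= ilint N g)%E.
Proof.
elim: N f g => [|N IH] f g mf mg f0 fg //=.
have g0 s : (0 <= g s)%E by exact: le_trans (fg s).
apply: ge0_le_integral => //.
- by move=> x _; exact: ilint_ge0.
- exact: measurable_ilint_scons.
- exact: measurable_ilint_scons.
- by move=> x _; apply: IH => //; exact: cmeas_scons.
Qed.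

Lemma ilintZl N (f : (nat -> R) -> \bar R) (k : \bar R) : cmeas f ->
  (forall s, (0 <= f s)%E) -> (0 <= k)%E ->
  ilint N (fun s => k * f s)%E = (k * ilint N f)%E.
Proof.
move=> + + k0; elim: N f => [|N IH] f mf f0 //=.
rewrite -ge0_integralZl //; first last.
- by move=> x _; exact: ilint_ge0.
- exact: measurable_ilint_scons.
by apply: eq_integral => x _; apply: IH => //; exact: cmeas_scons.
Qed.

Lemma ilintZr N (f : (nat -> R) -> \bar R) (k : \bar R) : cmeas f ->
  (forall s, (0 <= f s)%E) -> (0 <= k)%E ->
  ilint N (fun s => f s * k)%E = (ilint N f * k)%E.
Proof.
move=> mf f0 k0; rewrite [RHS]muleC -(ilintZl N mf)//.
by apply: eq_ilint => s _; rewrite muleC.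
Qed.

Lemma ilintD N (f g : (nat -> R) -> \bar R) : cmeas f -> cmeas g ->
  (forall s, (0 <= f s)%E) -> (forall s, (0 <= g s)%E) ->
  ilint N (fun s => f s + g s)%E = (ilint N f + ilint N g)%E.
Proof.
elim: N f g => [|N IH] f g mf mg f0 g0 //=.
rewrite -ge0_integralD //.
- by apply: eq_integral => x _; apply: IH => //; exact: cmeas_scons.
- by move=> x _; exact: ilint_ge0.
- exact: measurable_ilint_scons.
- by move=> x _; exact: ilint_ge0.
- exact: measurable_ilint_scons.
Qed.

Lemma integral_ilint_swap N (g : measurableTypeR R -> (nat -> R) -> \bar R) :
  pmeas g -> (forall x s, (0 <= g x s)%E) ->
  (\int[mu]_x ilint N (g x) = ilint N (fun s => \int[mu]_x g x s))%E.
Proof.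
elim: N g => [|N IH] g mg g0 //=.
have mg' : pmeas (fun (z : measurableTypeR R * measurableTypeR R) s =>
    g z.1 (scons z.2 s)).
  move=> d T h X mh mX; apply: (mg _ _ (fst \o h)
    (fun i t => scons (h t).2 (fun j => X j t) i)).
    exact: measurableT_comp.
  by apply: measurable_scons => //; exact: measurableT_comp.
rewrite (@fubini_tonelli _ _ (measurableTypeR R) (measurableTypeR R) R mu mu
  (fun z => ilint N (fun s => g z.1 (scons z.2 s))))/=; last 2 first.
- exact: pmeas_ilint.
- by move=> z; apply: ilint_ge0.
apply: eq_integral => y _; apply: IH => //.
move=> d T h X mh mX; apply: (mg _ _ h
    (fun i t => scons y (fun j => X j t) i)) => //.
exact: measurable_scons.
Qed.

Lemma ilint_swap N M (f : (nat -> R) -> (nat -> R) -> \bar R) : cmeas2 f ->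
  (forall s t, (0 <= f s t)%E) ->
  ilint N (fun s => ilint M (f s)) = ilint M (fun t => ilint N (fun s => f s t)).
Proof.
elim: N f => [|N IH] f mf f0 //=.
transitivity (\int[mu]_x ilint M (fun t => ilint N (fun s => f (scons x s) t)))%E.
  apply: eq_integral => x _; apply: (IH (fun s => f (scons x s))) => // d T X Y mX mY.
  apply: (mf _ _ (fun i t => scons x (fun j => X j t) i)) => //.
  exact: measurable_scons.
rewrite integral_ilint_swap //.
- move=> d T h X mh mX.
  apply: (@pmeas_ilint N _ T (fun t s => f (scons (h t) s) (fun i => X i t))) => //.
  move=> d' T' k Y mk mY.
  apply: (mf _ _ (fun i t => scons (h (k t)) (fun j => Y j t) i)
           (fun i t => X i (k t))).
    by apply: measurable_scons => //; exact: (measurableT_comp mh).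
  by move=> i; exact: (measurableT_comp (mX i)).
- by move=> x s; apply: ilint_ge0.
Qed.

Definition catn N (s t : nat -> R) : nat -> R :=
  fun i => if (i < N)%N then s i else t (i - N)%N.

Lemma ilint_catn N M (f : (nat -> R) -> \bar R) :
  ilint (N + M) f = ilint N (fun s => ilint M (fun t => f (catn N s t))).
Proof.
elim: N f => [|N IH] f /=.
  apply: eq_ilint => s _; congr (f _); apply/funext => i.
  by rewrite /catn /= subn0.
apply: eq_integral => x _; rewrite IH; apply: eq_ilint => s _.
by apply: eq_ilint => t _; congr (f _); apply/funext => -[|i].
Qed.

(** The image of Lebesgue measure under multiplication by [l], times [l], has the right mass on
    half-open intervals, so it is Lebesgue measure by uniqueness; what remains is integration
    against a pushforward. *)
Lemma lebesgue_scale (l : R) (f : R -> \bar R) : 0 < l ->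
  measurable_fun setT f -> (forall x, (0 <= f x)%E) ->
  (\int[mu]_x f x = l%:E * \int[mu]_x f (l * x)%R)%E.
Proof.
move=> l0 mf f0.
have mphi : measurable_fun setT (fun x : R => l * x) by exact: measurable_funM.
pose phi : measurableTypeR R -> measurableTypeR R := fun x => l * x.
pose l1 : {nonneg R} := NngNum (ltW l0).
pose nuf : {measure set _ -> \bar R} := mscale l1 (pushforward mu phi).
have mphi' : measurable_fun setT phi by exact: mphi.
pose nu := nuf mphi'.
transitivity (\int[nu]_x f x)%E.
  apply: eq_measure_integral => A mA _; apply: lebesgue_measure_unique => //.
  move=> _ [[a b]] _ <-; rewrite /nu /nuf /= /mscale /pushforward.
  have E : (phi @^-1` `]a, b] = `]a / l, b / l])%classic.
    apply/seteqP; split => x /=; rewrite !in_itv /= /phi;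
      by rewrite ltr_pdivrMr // ler_pdivlMr // mulrC.
  rewrite [RHS](_ : _ = (l%:E * mu (phi @^-1` `]a, b]))%E)// E.
  rewrite !lebesgue_measure_itv /= !lte_fin ltr_pM2r ?invr_gt0//.
  case: ifP => _; last by rewrite mule0.
  by rewrite -!EFinD -EFinM -mulrBl mulrC divfK// gt_eqF.
rewrite ge0_integral_mscale//; congr (_ * _)%E.
by rewrite ge0_integral_pushforward// preimage_setT.
Qed.

Lemma ilint_scale N (l : R) (f : (nat -> R) -> \bar R) : 0 < l ->
  cmeas f -> (forall s, (0 <= f s)%E) ->
  (ilint N f = (l ^+ N)%:E * ilint N (fun s => f (fun i => l * s i)%R))%E.
Proof.
move=> l0; elim: N f => [|N IH] f mf f0 /=.
  by rewrite mul1e; congr (f _); apply/funext => i; rewrite mulr0.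
have cm : cmeas (fun s => f (fun i => l * s i)).
  move=> d T X mX; apply: (mf _ _ (fun i t => l * X i t)) => i.
  exact: measurable_funM.
rewrite (lebesgue_scale l0); last 2 first.
- exact: measurable_ilint_scons.
- by move=> x; exact: ilint_ge0.
rewrite exprS EFinM -muleA; congr (_ * _)%E.
rewrite -ge0_integralZl//; last 3 first.
- exact: (measurable_ilint_scons N cm).
- by move=> x _; exact: ilint_ge0.
- by rewrite lee_fin exprn_ge0// ltW.
apply: eq_integral => x _; rewrite IH//; last exact: cmeas_scons.
congr (_ * _)%E; apply: eq_ilint => s _; congr (f _).
by apply/funext => -[|i].
Qed.

Lemma ilint_prod N (h : R -> R) : measurable_fun setT h -> (forall x, 0 <= h x) ->
  ilint N (fun s => (\prod_(t < N) h (s t))%:E) =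
  (\prod_(t < N) \int[mu]_x (h x)%:E)%E.
Proof.
move=> mh h0; elim: N => [|N IH]; first by rewrite /= !big_ord0.
rewrite big_ord_recl -IH -ge0_integralZr//=; last 3 first.
- exact/measurable_EFinP.
- by move=> x _; rewrite lee_fin.
- by apply: ilint_ge0 => s; rewrite lee_fin prodr_ge0.
apply: eq_integral => x _; rewrite -ilintZl; last 3 first.
- move=> d T X mX; apply/measurable_EFinP.
  apply: (@measurable_prod _ _ _ setT _ _ (fun i t => h (X (nat_of_ord i) t))) => i _.
  exact: (measurableT_comp mh).
- by move=> s; rewrite lee_fin prodr_ge0.
- by rewrite lee_fin.
by apply: eq_ilint => s _; rewrite big_ord_recl EFinM.
Qed.

(** The hyperplane [s 0 = 0] stands in for the origin: it is negligible already for the outermost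
    integral, and off it the norm is positive and may serve as a dilation factor. *)
Lemma ilint_ae N (f g : (nat -> R) -> \bar R) : cmeas f -> cmeas g ->
  (forall s, (0 <= f s)%E) -> (forall s, (0 <= g s)%E) ->
  (forall s, s 0%N != 0 -> f s = g s) -> ilint N.+1 f = ilint N.+1 g.
Proof.
move=> mf mg f0 g0 fg /=; apply: ge0_ae_eq_integral => //.
- exact: (measurable_ilint_scons N mf).
- exact: (measurable_ilint_scons N mg).
- by move=> x _; exact: ilint_ge0.
- by move=> x _; exact: ilint_ge0.
exists [set 0]%classic; split => //; first exact: lebesgue_measure_set1.
move=> x /=; apply: contra_notP => /eqP x0 _.
by apply: eq_ilint => s _; apply: fg.
Qed.

End IteratedIntegral.

(** * Radial functions *)

Section Radial.
Context {R : realType}.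

Definition rmeas (f : (nat -> R) -> R) : Prop :=
  forall d (T : measurableType d) (X : nat -> T -> R),
    (forall i, measurable_fun setT (X i)) ->
    measurable_fun setT (fun t => f (fun i => X i t)).

Lemma rmeas_cmeas (f : (nat -> R) -> R) : rmeas f -> cmeas (fun s => (f s)%:E).
Proof. by move=> mf d T X mX; apply/measurable_EFinP; exact: mf. Qed.

Lemma cmeas2_l (f : (nat -> R) -> (nat -> R) -> \bar R) s : cmeas2 f -> cmeas (f s).
Proof. by move=> mf d T X mX; apply: (mf _ _ (fun i _ => s i)). Qed.

Lemma cmeas2_r (f : (nat -> R) -> (nat -> R) -> \bar R) t :
  cmeas2 f -> cmeas (fun s => f s t).
Proof. by move=> mf d T X mX; apply: (mf _ _ _ (fun i _ => t i)). Qed.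

Lemma cmeas2C (f : (nat -> R) -> (nat -> R) -> \bar R) :
  cmeas2 f -> cmeas2 (fun s t => f t s).
Proof. by move=> mf d T X Y mX mY; apply: mf. Qed.

(** On nonnegative functions the inverse is the power of exponent -1, including the value 0 at 0, so
    measurability of [powR] applies. *)
Lemma measurable_inv_ge0 d (T : measurableType d) (g : T -> R) :
  (forall t, 0 <= g t) -> measurable_fun setT g ->
  measurable_fun setT (fun t => (g t)^-1).
Proof.
move=> g0 mg; rewrite [X in measurable_fun _ X](_ : _ = (fun t => g t `^ (-1))).
  exact: (measurableT_comp (@measurable_powR R _)).
by apply/funext => t; rewrite powR_inv1.
Qed.

Lemma measurable_sqrt_ge0 d (T : measurableType d) (g : T -> R) :
  (forall t, 0 <= g t) -> measurable_fun setT g ->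
  measurable_fun setT (fun t => Num.sqrt (g t)).
Proof.
move=> g0 mg; rewrite [X in measurable_fun _ X](_ : _ = (fun t => g t `^ 2^-1)).
  exact: (measurableT_comp (@measurable_powR R _)).
by apply/funext => t; rewrite powR12_sqrt.
Qed.

Lemma cmeas_smul (l : R) (f : (nat -> R) -> \bar R) : cmeas f ->
  cmeas (fun s => f (fun i => l * s i)).
Proof.
move=> mf d T X mX; apply: (mf _ _ (fun i t => l * X i t)) => i.
exact: measurable_funM.
Qed.

Definition sqn N (s : nat -> R) : R := \sum_(t < N) s t ^+ 2.
Definition nrm N (s : nat -> R) : R := Num.sqrt (sqn N s).
Definition smul (l : R) (s : nat -> R) : nat -> R := fun i => l * s i.

Lemma sqn_ge0 N s : 0 <= sqn N s.
Proof. by apply: sumr_ge0 => i _; exact: sqr_ge0. Qed.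

Lemma nrm_ge0 N s : 0 <= nrm N s.
Proof. exact: sqrtr_ge0. Qed.

Lemma sqr_nrm N s : nrm N s ^+ 2 = sqn N s.
Proof. by rewrite sqr_sqrtr// sqn_ge0. Qed.

Lemma nrm_smul N l s : 0 <= l -> nrm N (smul l s) = l * nrm N s.
Proof.
move=> l0; rewrite /nrm /sqn /smul; under eq_bigr do rewrite exprMn.
by rewrite -mulr_sumr sqrtrM ?sqr_ge0// sqrtr_sqr ger0_norm.
Qed.

Lemma nrm_gt0 N s : s 0%N != 0 -> 0 < nrm N.+1 s.
Proof.
move=> s0; rewrite sqrtr_gt0 /sqn big_ord_recl ltr_pwDl//.
  by rewrite lt_neqAle sqr_ge0 andbT eq_sym expf_eq0.
by apply: sumr_ge0 => i _; exact: sqr_ge0.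
Qed.

Lemma measurable_smul d (T : measurableType d) (l : T -> R) (X : nat -> T -> R) :
  measurable_fun setT l -> (forall i, measurable_fun setT (X i)) ->
  forall i, measurable_fun setT (fun t => smul (l t) (fun j => X j t) i).
Proof. by move=> ml mX i; apply: measurable_funM => //; exact: mX. Qed.

Lemma rmeas_sqn N : rmeas (sqn N).
Proof.
move=> d T X mX.
apply: (@measurable_sum _ _ _ setT _ _ (fun i t => X (nat_of_ord i) t ^+ 2)) => i.
exact: measurable_funX.
Qed.

Lemma rmeas_nrm N : rmeas (nrm N).
Proof.
move=> d T X mX; apply: measurable_sqrt_ge0; last exact: rmeas_sqn.
by move=> t; exact: sqn_ge0.
Qed.

Lemma rmeas_inv_nrm N : rmeas (fun s => (nrm N s)^-1).
Proof.
move=> d T X mX; apply: measurable_inv_ge0; last exact: rmeas_nrm.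
by move=> t; exact: nrm_ge0.
Qed.

(** * Separation of radius and direction *)

Section Polar.
Variables (D : nat) (q : (nat -> R) -> R) (phi psi : R -> R).
Hypotheses (mq : rmeas q) (q0 : forall s, 0 <= q s).
Hypothesis qh : forall l s, 0 < l -> q (smul l s) = q s.
Hypotheses (mphi : measurable_fun setT phi) (mpsi : measurable_fun setT psi).
Hypotheses (phi0 : forall x, 0 <= phi x) (psi0 : forall x, 0 <= psi x).
Local Notation N := D.+1.
Local Notation nn := (nrm N).

(** Integrands of one double integral before and after each of three substitutions. From [F2] to
    [F3] homogeneity removes the dilation from the argument of [q]; in [F4] the Jacobian has
    cancelled the powers of [nn w], and the two variables separate. *)
Let F1 x y := (phi (nn x) * q x * psi (nn y))%:E.
Let F2 x z := ((nn x) ^+ N * (phi (nn x) * q x * psi ((nn x) * (nn z))))%:E.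
Let F3 z w := ((nn z)^-1 ^+ N * (((nn w) * (nn z)^-1) ^+ N
   * (phi ((nn w) * (nn z)^-1) * q w * psi (nn w))))%:E.
Let F4 w v := (psi (nn w) * q w * (((nn v)^-1 ^+ N) ^+ 2 * phi (nn v)^-1))%:E.

Let mn d (T : measurableType d) (X : nat -> T -> R) :
  (forall i, measurable_fun setT (X i)) ->
  measurable_fun setT (fun t => (nn (fun i => X i t))).
Proof. exact: rmeas_nrm. Qed.
Let mnV d (T : measurableType d) (X : nat -> T -> R) :
  (forall i, measurable_fun setT (X i)) ->
  measurable_fun setT (fun t => (nn (fun i => X i t))^-1).
Proof. exact: rmeas_inv_nrm. Qed.

Let mF1 : cmeas2 F1.
Proof.
move=> d T X Y mX mY; apply/measurable_EFinP; apply: measurable_funM.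
  by apply: measurable_funM; [apply: (measurableT_comp mphi); exact: mn|exact: mq].
by apply: (measurableT_comp mpsi); exact: mn.
Qed.
Let mF2 : cmeas2 F2.
Proof.
move=> d T X Y mX mY; apply/measurable_EFinP; apply: measurable_funM.
  by apply: measurable_funX; exact: mn.
apply: measurable_funM.
  by apply: measurable_funM; [apply: (measurableT_comp mphi); exact: mn|exact: mq].
by apply: (measurableT_comp mpsi); apply: measurable_funM; exact: mn.
Qed.
Let mF3 : cmeas2 F3.
Proof.
move=> d T X Y mX mY.
have m1 : measurable_fun setT (fun t => (nn (fun i => Y i t)) * (nn (fun i => X i
  t))^-1).
  by apply: measurable_funM; [exact: mn|exact: mnV].
apply/measurable_EFinP; apply: measurable_funM.
  by apply: measurable_funX; exact: mnV.
apply: measurable_funM; first exact: measurable_funX.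
apply: measurable_funM.
  by apply: measurable_funM; [exact: (measurableT_comp mphi)|exact: mq].
by apply: (measurableT_comp mpsi); exact: mn.
Qed.
Let mF4 : cmeas2 F4.
Proof.
move=> d T X Y mX mY; apply/measurable_EFinP; apply: measurable_funM.
  by apply: measurable_funM; [apply: (measurableT_comp mpsi); exact: mn|exact: mq].
apply: measurable_funM.
  by apply: measurable_funX; apply: measurable_funX; exact: mnV.
by apply: (measurableT_comp mphi); exact: mnV.
Qed.
Let F1ge0 x y : (0 <= F1 x y)%E.
Proof. by rewrite lee_fin !mulr_ge0. Qed.
Let F2ge0 x y : (0 <= F2 x y)%E.
Proof. by rewrite lee_fin !mulr_ge0 ?exprn_ge0 ?nrm_ge0. Qed.
Let F3ge0 x y : (0 <= F3 x y)%E.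
Proof.
by rewrite lee_fin !mulr_ge0// ?exprn_ge0// ?mulr_ge0 ?invr_ge0 ?nrm_ge0.
Qed.
Let F4ge0 x y : (0 <= F4 x y)%E.
Proof. by rewrite lee_fin !mulr_ge0// ?exprn_ge0 ?invr_ge0 ?nrm_ge0. Qed.

(* The last factor does not depend on [q] and [psi]: this replaces polar coordinates.
   It follows from the substitutions [y := |x| z], [x := w / |z|], [z := |w| v],
   separated by Tonelli swaps. *)
Lemma polar_swap :
  (ilint N (fun s => (phi (nn s) * q s)%:E) * ilint N (fun s => (psi (nn s))%:E) =
   ilint N (fun s => (psi (nn s) * q s)%:E) *
   ilint N (fun s => (((nn s)^-1 ^+ N) ^+ 2 * phi (nn s)^-1)%:E))%E.
Proof.
have cpq (h : R -> R) : measurable_fun setT h ->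
    cmeas (fun s => (h (nn s) * q s)%:E).
  move=> mh; apply: rmeas_cmeas => d T X mX; apply: measurable_funM => //.
    by apply: (measurableT_comp mh); exact: mn.
  exact: mq.
have c1 (h : R -> R) : measurable_fun setT h -> cmeas (fun s => (h (nn s))%:E).
  by move=> mh; apply: rmeas_cmeas => d T X mX; apply: (measurableT_comp mh); exact: mn.
have c4 : cmeas (fun s => (((nn s)^-1 ^+ N) ^+ 2 * phi (nn s)^-1)%:E).
  apply: rmeas_cmeas => d T X mX; apply: measurable_funM.
    by apply: measurable_funX; apply: measurable_funX; exact: mnV.
  by apply: (measurableT_comp mphi); exact: mnV.
have e1 s : ((phi (nn s) * q s)%:E * ilint N (fun s => (psi (nn s))%:E))%E =
    ilint N (F1 s).
  rewrite -ilintZl; [by []|exact: c1|by move=> ?;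
    rewrite lee_fin|by rewrite lee_fin mulr_ge0].
have e4 s : ((psi (nn s) * q s)%:E * ilint N (fun v =>
    (((nn v)^-1 ^+ N) ^+ 2 * phi (nn v)^-1)%:E))%E = ilint N (F4 s).
  rewrite -ilintZl; [by []|exact: c4| |by rewrite lee_fin mulr_ge0].
  by move=> ?; rewrite lee_fin !mulr_ge0 ?exprn_ge0 ?invr_ge0 ?nrm_ge0.
rewrite -ilintZr; [|exact: cpq|by move=> ?; rewrite lee_fin mulr_ge0
  |by apply: ilint_ge0 => ?; rewrite lee_fin].
rewrite -ilintZr; [|exact: cpq|by move=> ?; rewrite lee_fin mulr_ge0
  |by apply: ilint_ge0 => ?; rewrite lee_fin !mulr_ge0 ?exprn_ge0 ?invr_ge0 ?nrm_ge0].
rewrite (eq_ilint _ (g := fun s => ilint N (F1 s))); last by move=> s _; rewrite e1.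
rewrite [RHS](eq_ilint _ (g := fun s => ilint N (F4 s))); last by move=> s _;
  rewrite e4.
have E12 : ilint N (fun x => ilint N (F1 x)) = ilint N (fun x => ilint N (F2 x)).
  apply: ilint_ae; [exact: cmeas_ilint|exact: cmeas_ilint| | |].
  - by move=> s; exact: ilint_ge0.
  - by move=> s; exact: ilint_ge0.
  move=> x x0; have nx := @nrm_gt0 D _ x0.
  rewrite (ilint_scale _ nx (cmeas2_l _ mF1))//.
  rewrite -ilintZl; [|exact: cmeas_smul _ (cmeas2_l _ mF1)|by []
    |by rewrite lee_fin exprn_ge0 ?ltW].
  apply: eq_ilint => s _; rewrite /F1 /F2 -EFinM.
  by rewrite -/(smul _ _) nrm_smul ?ltW.
rewrite {}E12 (ilint_swap _ _ mF2)//.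
have E23 : ilint N (fun z => ilint N (fun x => F2 x z)) =
   ilint N (fun z => ilint N (F3 z)).
  apply: ilint_ae; [apply: cmeas_ilint => //; exact: cmeas2C
    |exact: cmeas_ilint| | |].
  - by move=> s; exact: ilint_ge0.
  - by move=> s; exact: ilint_ge0.
  move=> z z0; have nz := @nrm_gt0 D _ z0.
  have iz : 0 < (nn z)^-1 by rewrite invr_gt0.
  rewrite (ilint_scale _ iz (cmeas2_r _ mF2))//.
  rewrite -ilintZl; [|exact: cmeas_smul _ (cmeas2_r _ mF2)|by []
    |by rewrite lee_fin exprn_ge0 ?ltW].
  apply: eq_ilint => s _; rewrite /F2 /F3 -EFinM -/(smul _ _) nrm_smul ?ltW// qh//.
  congr ((_ * (_ * _))%:E); first by rewrite mulrC.
  by rewrite (mulrC _ (nn s)) divfK// gt_eqF.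
rewrite {}E23 (ilint_swap _ _ mF3)//.
apply: ilint_ae; [apply: cmeas_ilint => //; exact: cmeas2C
    |exact: cmeas_ilint| | |].
- by move=> s; exact: ilint_ge0.
- by move=> s; exact: ilint_ge0.
move=> w w0; have nw := @nrm_gt0 D _ w0.
rewrite (ilint_scale _ nw (cmeas2_r _ mF3))//.
rewrite -ilintZl; [|exact: cmeas_smul _ (cmeas2_r _ mF3)|by []
  |by rewrite lee_fin exprn_ge0 ?ltW].
apply: eq_ilint => s _; rewrite /F3 /F4 -EFinM -/(smul _ _) nrm_smul ?ltW//.
have -> : nn w / (nn w * nn s) = (nn s)^-1 by rewrite invfM mulrA divff ?gt_eqF// mul1r.
have w1 : nn w ^+ N * (nn w)^-1 ^+ N = 1 by rewrite -exprMn divff ?gt_eqF// expr1n.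
congr (_%:E); rewrite invfM exprMn.
move: w1; set a := nn w ^+ N; set b := (nn w)^-1 ^+ N; set c := (nn s)^-1 ^+ N.
move=> w1; have -> : psi (nn w) * q w * (c ^+ 2 * phi (nn s)^-1) =
  (a * b) * (psi (nn w) * q w * (c ^+ 2 * phi (nn s)^-1)) by rewrite w1 mul1r.
by clearbody a b c; ring.
Qed.
End Polar.
End Radial.

(** * Gaussian and uniform columns *)

Section Densities.
Context {R : realType}.
Local Notation mu := (@lebesgue_measure R).

Lemma gauss_dens_ge0 (v x : R) : 0 <= gauss_dens v x.
Proof. by rewrite divr_ge0 ?expR_ge0 ?sqrtr_ge0. Qed.

Lemma measurable_gauss_dens (v : R) : measurable_fun setT (gauss_dens v).
Proof.
apply: measurable_funM => //; apply: (measurableT_comp (@measurable_expR R)).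
by apply: measurable_funM => //; apply: measurableT_comp => //.
Qed.

Lemma integral_gauss_dens (v : R) : 0 < v ->
  (\int[mu]_x (gauss_dens v x)%:E = 1)%E.
Proof.
move=> v0; rewrite -(integral_normal_pdf 0 (Num.sqrt v)).
apply: eq_integral => x _; congr (_%:E).
rewrite normal_pdfE ?gt_eqF ?sqrtr_gt0// /normal_peak /normal_fun.
rewrite subr0 sqr_sqrtr ?ltW// [RHS]mulrC /gauss_dens.
have -> : v *+ 2 = 2 * v by rewrite mulr_natl.
by have -> : v * pi *+ 2 = 2 * pi * v by rewrite -mulr_natl; ring.
Qed.

(* Comparing the densities of variances [v] and [v * w ^+ 2] through
   [1 + y <= expR y] bounds the second moment by [v * w ^+ 2]. *)
Lemma integral_sqr_gauss_dens (v : R) : 0 < v ->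
  (\int[mu]_x (x ^+ 2 * gauss_dens v x)%:E <= v%:E)%E.
Proof.
move=> v0; set M := (\int[mu]_x _)%E.
have g0 x : 0 <= x ^+ 2 * gauss_dens v x by rewrite mulr_ge0 ?sqr_ge0 ?gauss_dens_ge0.
have mg : measurable_fun setT (fun x : R => (x ^+ 2 * gauss_dens v x)%:E).
  by apply/measurable_EFinP; apply: measurable_funM;
    [exact: measurable_funX|exact: measurable_gauss_dens].
have mgd u : measurable_fun setT (fun x : R => (gauss_dens u x)%:E).
  by apply/measurable_EFinP; exact: measurable_gauss_dens.
have M0 : (0 <= M)%E by apply: integral_ge0 => x _; rewrite lee_fin.
(* With [k = (1 - w^-2) / (2 * v)], this integrates [(1 + k * x^2) * g x <= expR (k * x^2) * g x],
   where [g] is the density of variance [v] and the right side is [w] times the density of variance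
   [v * w^2]. *)
have key w : 1 < w -> (1 + ((1 - w ^- 2) / (2 * v))%:E * M <= w%:E)%E.
  move=> w1; have w0 : 0 < w by lra.
  have k0 : 0 <= (1 - w ^- 2) / (2 * v).
    apply: divr_ge0; last by rewrite mulr_ge0 ?ltW.
    by rewrite subr_ge0 invf_le1 ?exprn_gt0// exprn_ege1// ltW.
  rewrite -{1}(integral_gauss_dens v0) -ge0_integralZl//; last by move=> x _;
    rewrite lee_fin.
  rewrite -ge0_integralD; [|by []|by move=> x _;
    rewrite lee_fin gauss_dens_ge0|exact: mgd
    |by move=> x _; rewrite -EFinM lee_fin mulr_ge0|exact: measurable_funeM].
  have vw : 0 < v * w ^+ 2 by rewrite mulr_gt0 ?exprn_gt0.
  rewrite -[leRHS]mule1 -(integral_gauss_dens vw) -ge0_integralZl; [|by []|exact: mgd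
    |by move=> x _; rewrite lee_fin gauss_dens_ge0|by rewrite lee_fin ltW].
  apply: ge0_le_integral => //.
  - move=> x _; rewrite -EFinM -EFinD lee_fin addr_ge0 ?gauss_dens_ge0//.
    by rewrite mulr_ge0.
  - by apply: emeasurable_funD; [exact: mgd|exact: measurable_funeM].
  - by apply: measurable_funeM; exact: mgd.
  move=> x _; rewrite -!EFinM -EFinD lee_fin /gauss_dens.
  have -> : 2 * pi * (v * w ^+ 2) = 2 * pi * v * w ^+ 2 by ring.
  rewrite (@sqrtrM _ (2 * pi * v)) ?mulr_ge0 ?pi_ge0 ?(ltW v0)// sqrtr_sqr gtr0_norm//.
  set S := Num.sqrt _.
  have -> : - x ^+ 2 / (2 * (v * w ^+ 2)) =
      (1 - w ^- 2) / (2 * v) * x ^+ 2 + (- x ^+ 2 / (2 * v)).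
    by field; rewrite !gt_eqF.
  rewrite expRD; set e := expR (- _ / _).
  have -> : w * (expR ((1 - w ^- 2) / (2 * v) * x ^+ 2) * e / (S * w)) =
     expR ((1 - w ^- 2) / (2 * v) * x ^+ 2) * (e / S).
    rewrite mulrC -!mulrA; congr (_ * (_ * _)).
    by rewrite invfM mulfVK// gt_eqF.
  have -> : e / S + (1 - w ^- 2) / (2 * v) * (x ^+ 2 * (e / S)) =
    (1 + (1 - w ^- 2) / (2 * v) * x ^+ 2) * (e / S).
    by ring.
  rewrite ler_wpM2r ?expR_ge1Dx// divr_ge0 ?expR_ge0 ?sqrtr_ge0//.
(* The single value [w = 2] excludes an infinite second moment, since the coefficient of [M] in
   [key] is positive. *)
have Mfin : M \is a fin_num.
  have := key 2 (ltr1n _ 2); rewrite ge0_fin_numE//.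
  case: (M) M0 => [m| |] //= _; rewrite ?ltry// gt0_muley//.
  by rewrite lte_fin divr_gt0 ?mulr_gt0// subr_gt0 invf_lt1//; lra.
move: key M0; rewrite -(fineK Mfin); set m := fine M => key.
rewrite !lee_fin => m0; rewrite leNgt; apply/negP => vm.
(* Chosen so that [w > 1] and [m = v * (2 * w^2 - 1)]; [key] then reduces to [2 * w^3 <= w + 1],
   which is impossible for [w > 1]. *)
pose w := Num.sqrt ((1 + m / v) / 2).
have mv : 1 < m / v by rewrite ltr_pdivlMr// mul1r.
have ww : w ^+ 2 = (1 + m / v) / 2 by rewrite sqr_sqrtr//; lra.
have w1 : 1 < w by rewrite -sqrtr1 ltr_sqrt; lra.
have := key w w1; rewrite -EFinM -EFinD lee_fin ww => H.
have mE : m = v * (2 * w ^+ 2 - 1) by rewrite ww; field; rewrite gt_eqF.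
move: H; rewrite -ww {1}mE.
have -> : (1 - w ^- 2) / (2 * v) * (v * (2 * w ^+ 2 - 1)) =
   (w - 1) * ((w + 1) * (2 * w ^+ 2 - 1) / (2 * w ^+ 2)).
  by field; rewrite !gt_eqF//; lra.
have w2 : 0 < 2 * w ^+ 2 by rewrite mulr_gt0// exprn_gt0; lra.
move=> H; have : (w + 1) * (2 * w ^+ 2 - 1) / (2 * w ^+ 2) <= 1.
  rewrite -(@ler_pM2l _ (w - 1)); lra.
rewrite ler_pdivrMr// mul1r; nra.
Qed.

End Densities.

(** * Gaussian and ball weights on a single column *)

Section Column.
Context {R : realType}.
Local Notation mu := (@lebesgue_measure R).

Definition box (r x : R) : R := if `|x| <= r then 1 else 0.

Lemma box_ge0 r x : 0 <= box r x.
Proof. by rewrite /box; case: ifP. Qed.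

Lemma measurable_box r : measurable_fun setT (box r).
Proof.
by apply: measurable_fun_ifT => //; apply: measurable_fun_ler.
Qed.

Lemma integral_box r : 0 < r -> (\int[mu]_x (box r x)%:E = (r + r)%:E)%E.
Proof.
move=> r0; transitivity (\int[mu]_x (\1_`[- r, r]%classic x)%:E)%E.
  apply: eq_integral => x _; rewrite /box indicE.
  by rewrite mem_setE in_itv /= -ler_norml; case: ifP.
rewrite integral_indic//= setIT lebesgue_measure_itv /= lte_fin gtrN// -EFinD.
by rewrite opprK.
Qed.

Definition ball1 (N : nat) (s : nat -> R) : R := if nrm N s <= 1 then 1 else 0.

Lemma ball1_ge0 N s : 0 <= ball1 N s.
Proof. by rewrite /ball1; case: ifP. Qed.

Lemma rmeas_ball1 N : rmeas (ball1 N).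
Proof.
move=> d T X mX; apply: measurable_fun_ifT => //; apply: measurable_fun_ler => //.
exact: rmeas_nrm.
Qed.

Lemma rmeas_prod N (h : R -> R) : measurable_fun setT h ->
  rmeas (fun s => \prod_(t < N) h (s t)).
Proof.
move=> mh d T X mX.
apply: (@measurable_prod _ _ _ setT _ _ (fun i t => h (X (nat_of_ord i) t))) => i _.
exact: (measurableT_comp mh).
Qed.

Lemma prod_box_ge0 N r s : 0 <= \prod_(t < N) box r (s t).
Proof. by apply: prodr_ge0 => t _; exact: box_ge0. Qed.

Lemma prod_box N r s : \prod_(t < N) box r (s t) =
  if [forall t : 'I_N, `|s t| <= r] then 1 else 0.
Proof.
case: ifPn => [/forallP h|].
  by rewrite big1// => t _; rewrite /box h.
rewrite negb_forall => /existsP[t /negbTE ht].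
by rewrite (bigD1 t)//= /box ht mul0r.
Qed.

(** The ball lies between the cubes of half-sides [1 / N.+1] and 1, whose volumes are given by
    [ilint_prod]. Finiteness and positivity are what make division by [fine (ball_vol _)] a true
    normalisation. *)
Lemma ball_volE N : exists2 V : R, 0 < V & ball_vol N.+1 = V%:E.
Proof.
have mb : cmeas (fun s => (ball1 N.+1 s)%:E) by apply: rmeas_cmeas; exact: rmeas_ball1.
have mx r : cmeas (fun s => (\prod_(t < N.+1) box r (s t))%:E).
  by apply: rmeas_cmeas; apply: rmeas_prod; exact: measurable_box.
have le_box : (ball_vol (R := R) N.+1 <= (\prod_(t < N.+1) (1 + 1))%:E)%E.
  rewrite -prodEFin.
  under [leRHS]eq_bigr do rewrite -integral_box//.
  rewrite -ilint_prod; [|exact: measurable_box|exact: box_ge0].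
  apply: le_ilint => // s; first exact: ball1_ge0.
  rewrite lee_fin; case: ifPn => [s1|_]; last exact: prod_box_ge0.
  rewrite prod_box ifT//; apply/forallP => t.
  rewrite -(@ler_pXn2r _ 2) ?nnegrE// real_normK ?num_real// expr1n.
  have : nrm N.+1 s ^+ 2 <= 1 by rewrite expr_le1// nrm_ge0.
  rewrite sqr_nrm; apply: le_trans; rewrite /sqn (bigD1 t)//= lerDl.
  by apply: sumr_ge0 => i _; exact: sqr_ge0.
have ge_box : ((\prod_(t < N.+1) (N.+1%:R^-1 + N.+1%:R^-1))%:E <= ball_vol (R := R)
  N.+1)%E.
  rewrite -prodEFin.
  under [leLHS]eq_bigr do rewrite -integral_box ?invr_gt0//.
  rewrite -ilint_prod; [|exact: measurable_box|exact: box_ge0].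
  apply: le_ilint => // s; first exact: prod_box_ge0.
  rewrite lee_fin prod_box; case: ifPn => [/forallP s1|_];
    last exact: (ball1_ge0 N.+1 s).
  rewrite ifT// -sqrtr1 ler_sqrt//.
  have -> : 1 = \sum_(t < N.+1) N.+1%:R^-1 :> R.
    by rewrite sumr_const card_ord -[RHS]mulr_natl divff ?pnatr_eq0.
  apply: ler_sum => t _; rewrite -real_normK ?num_real//.
  apply: (@le_trans _ _ (N.+1%:R^-1 ^+ 2)); first by rewrite ler_pXn2r ?nnegrE.
  by rewrite expr2 ger_pMr// invf_le1// ler1n.
move: le_box ge_box; case: (ball_vol N.+1) => [V| |]; last 2 first.
- by rewrite leye_eq.
- by rewrite leeNy_eq.
rewrite !lee_fin => _ h; exists V => //; apply: lt_le_trans h.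
by apply: prodr_gt0 => t _; rewrite addr_gt0 ?invr_gt0.
Qed.

Definition gaussN (v : R) N (s : nat -> R) : R := \prod_(t < N) gauss_dens v (s t).
Definition ballN N (s : nat -> R) : R := ball1 N s / fine (ball_vol (R := R) N).

Lemma gaussN_ge0 v N s : 0 <= gaussN v N s.
Proof. by apply: prodr_ge0 => t _; exact: gauss_dens_ge0. Qed.

Lemma rmeas_gaussN v N : rmeas (gaussN v N).
Proof. by apply: rmeas_prod; exact: measurable_gauss_dens. Qed.

(** The product density depends on the norm alone, which is what lets [ilint_polar] apply to the
    Gaussian weight. *)
Lemma gaussNE v N s : gaussN v N s =
  expR (- (nrm N s ^+ 2) / (2 * v)) / Num.sqrt (2 * pi * v) ^+ N.
Proof.
rewrite /gaussN /gauss_dens big_split /= prodfV prodr_const card_ord -expR_sum.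
by rewrite sqr_nrm /sqn -sumrN mulr_suml.
Qed.

Lemma ballN_ge0 N s : 0 <= ballN N s.
Proof.
rewrite divr_ge0 ?ball1_ge0// fine_ge0//; apply: ilint_ge0 => x.
exact: ball1_ge0.
Qed.

Lemma rmeas_ballN N : rmeas (ballN N).
Proof. by move=> d T X mX; apply: measurable_funM => //; exact: rmeas_ball1. Qed.

Lemma ilint_ballN1 N : ilint N.+1 (fun s => (ballN N.+1 s)%:E) = 1%E.
Proof.
have [V V0 VE] := ball_volE N.
transitivity (ilint N.+1 (fun s => (ball1 N.+1 s)%:E * (V^-1)%:E)%E).
  by apply: eq_ilint => s _; rewrite /ballN VE EFinM.
rewrite ilintZr; last by rewrite lee_fin invr_ge0 ltW.
- by rewrite -/(ball_vol N.+1) VE -EFinM divff// gt_eqF.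
- by apply: rmeas_cmeas; exact: rmeas_ball1.
- by move=> s; rewrite lee_fin ball1_ge0.
Qed.

Lemma ilint_gaussN1 v N : 0 < v -> ilint N (fun s => (gaussN v N s)%:E) = 1%E.
Proof.
move=> v0; rewrite ilint_prod; [|exact: measurable_gauss_dens|exact: gauss_dens_ge0].
by rewrite big1// => i _; rewrite integral_gauss_dens.
Qed.

(** Peeling off one coordinate splits the squared norm into two terms, and in each of them the part
    of the density that carries no square has mass 1. The upper bound is the useful direction, since
    it multiplies a nonnegative slope in [gauss_le_ball]. *)
Lemma ilint_gaussN_sqn v N : 0 < v ->
  (ilint N (fun s => (gaussN v N s * sqn N s)%:E) <= (N%:R * v)%:E)%E.
Proof.
move=> v0; elim: N => [|N IH] /=; first by rewrite /sqn big_ord0 mulr0 mul0r.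
have mS : cmeas (fun s => (gaussN v N s * sqn N s)%:E).
  by apply: rmeas_cmeas => d T X mX; apply: measurable_funM;
    [exact: rmeas_gaussN|exact: rmeas_sqn].
have mG : cmeas (fun s => (gaussN v N s)%:E) by apply: rmeas_cmeas; exact: rmeas_gaussN.
have S0 s : (0 <= (gaussN v N s * sqn N s)%:E)%E.
  by rewrite lee_fin mulr_ge0 ?gaussN_ge0 ?sqn_ge0.
have G0 s : (0 <= (gaussN v N s)%:E)%E by rewrite lee_fin gaussN_ge0.
have g0 x : (0 <= (gauss_dens v x)%:E)%E by rewrite lee_fin gauss_dens_ge0.
have x0 x : (0 <= (x ^+ 2 * gauss_dens v x)%:E)%E.
  by rewrite lee_fin mulr_ge0 ?sqr_ge0 ?gauss_dens_ge0.
have mg : measurable_fun setT (fun x => (gauss_dens v x)%:E).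
  by apply/measurable_EFinP; exact: measurable_gauss_dens.
have mxg : measurable_fun setT (fun x : R => (x ^+ 2 * gauss_dens v x)%:E).
  by apply/measurable_EFinP; apply: measurable_funM;
    [exact: measurable_funX|exact: measurable_gauss_dens].
set S := ilint N _ in IH.
have SN0 : (0 <= S)%E by exact: ilint_ge0.
rewrite (_ : (\int[mu]_x _)%E = (\int[mu]_x ((x ^+ 2 * gauss_dens v x)%:E +
    (gauss_dens v x)%:E * S))%E); last first.
  apply: eq_integral => x _; rewrite -ilintZl// -[X in (X + _)%E]mule1.
  rewrite -(ilint_gaussN1 N v0) -ilintZl// -ilintD//.
  - apply: eq_ilint => s _; rewrite -!EFinM -EFinD; congr (_%:E).
    rewrite /gaussN /sqn !big_ord_recl /=; ring.
  - by move=> d T X mX; apply: measurable_funeM; exact: mG.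
  - by move=> d T X mX; apply: measurable_funeM; exact: mS.
  - by move=> s; exact: mule_ge0.
  - by move=> s; exact: mule_ge0.
rewrite ge0_integralD//; last 2 first.
- by move=> x _; exact: mule_ge0.
- by apply: emeasurable_funM => //; exact: mg.
rewrite ge0_integralZr// integral_gauss_dens// mul1e.
rewrite -natr1 mulrDl mul1r EFinD addeC; apply: leeD => //.
exact: integral_sqr_gauss_dens.
Qed.

(** [polar_swap] is used twice with [psi] the normalised ball density, once for [q] and once for the
    constant 1. As [psi] has mass 1, the second use identifies the common last factor as the
    integral of the radial weight. *)
Lemma ilint_polar N (q : (nat -> R) -> R) (phi : R -> R) :
  rmeas q -> (forall s, 0 <= q s) -> (forall l s, 0 < l -> q (smul l s) = q s) ->
  measurable_fun setT phi -> (forall x, 0 <= phi x) ->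
  (ilint N.+1 (fun s => (phi (nrm N.+1 s) * q s)%:E) =
   ilint N.+1 (fun s => (phi (nrm N.+1 s))%:E) *
   ilint N.+1 (fun s => (ballN N.+1 s * q s)%:E))%E.
Proof.
move=> mq q0 qh mphi phi0; have [V V0 VE] := ball_volE N.
pose psi (r : R) : R := (if r <= 1 then 1 else 0) / V.
have mpsi : measurable_fun setT psi.
  apply: measurable_funM => //; apply: measurable_fun_ifT => //.
  exact: measurable_fun_ler.
have psi0 x : 0 <= psi x by apply: divr_ge0; [case: (x <= 1)|exact: ltW].
have psiE s : ballN N.+1 s = psi (nrm N.+1 s) by rewrite /ballN VE.
have H := @polar_swap R N _ _ _ _ _ _ mphi mpsi phi0 psi0.
have H1 := H (fun=> 1) (fun _ _ _ _ => measurable_cst _) (fun=> ler01) (fun _ _ _ =>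
  erefl).
have Hq := H q mq q0 qh.
have B1 : ilint N.+1 (fun s => (psi (nrm N.+1 s))%:E) = 1%E.
  by rewrite -(ilint_ballN1 N); apply: eq_ilint => s _; rewrite psiE.
have B1' : ilint N.+1 (fun s => (psi (nrm N.+1 s) * 1)%:E) = 1%E.
  by rewrite -[RHS]B1; apply: eq_ilint => s _; rewrite mulr1.
rewrite B1 mule1 in Hq; rewrite B1 mule1 B1' mul1e in H1.
rewrite Hq -H1 muleC; congr (_ * _)%E; apply: eq_ilint => s _.
  by rewrite mulr1.
by rewrite psiE.
Qed.

(** Radial projection onto the sphere of radius [r]. A vector of zero norm goes to zero, because the
    inverse of 0 is 0. *)
Definition rescale (r : R) N (s : nat -> R) : nat -> R := smul (r / nrm N s) s.

Lemma rescale_smul r N l s : 0 < l -> rescale r N (smul l s) = rescale r N s.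
Proof.
move=> l0; rewrite /rescale nrm_smul ?ltW//; apply/funext => i; rewrite /smul.
rewrite invfM; set c := (nrm N s)^-1.
rewrite [LHS](_ : _ = (l^-1 * l) * (r * c * s i)); last by ring.
by rewrite mulVf ?mul1r// gt_eqF.
Qed.

Lemma measurable_rescale r N d (T : measurableType d) (X : nat -> T -> R) :
  (forall i, measurable_fun setT (X i)) ->
  forall i, measurable_fun setT (fun t => rescale r N (fun j => X j t) i).
Proof.
move=> mX; apply: measurable_smul => //; apply: measurable_funM => //.
exact: rmeas_inv_nrm.
Qed.

Lemma rmeas_rescale r N f : rmeas f -> rmeas (fun s => f (rescale r N s)).
Proof.
move=> mf d T X mX; apply: (mf _ _ (fun i t => rescale r N (fun j => X j t) i)).
exact: measurable_rescale.
Qed.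

(* Jensen's inequality in the squared radius, through the tangent line of [ln] at the
   mean radius: its slope [q] depends on the direction only, so that [ilint_polar]
   decouples it from the radius. *)
Lemma gauss_le_ball N (v m : R) (f : (nat -> R) -> R) : 0 < v -> 0 < m ->
  N.+1%:R * v = m -> rmeas f ->
  (forall s, f s = f (fun=> 0) +
     sqn N.+1 s / m * (f (rescale (Num.sqrt m) N.+1 s) - f (fun=> 0))) ->
  1 <= f (fun=> 0) ->
  (forall s, f (fun=> 0) <= f (rescale (Num.sqrt m) N.+1 s)) ->
  (ilint N.+1 (fun s => (gaussN v N.+1 s * ln (f s))%:E) <=
   ilint N.+1 (fun s => (ballN N.+1 s * ln (f (rescale (Num.sqrt m) N.+1 s)))%:E))%E.
Proof.
move=> v0 m0 vm mf fE a1 fge.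
set a := f (fun=> 0) in fE a1 fge; set rs := rescale _ _ in fE fge *.
(* With [y = sqn N.+1 s / m], this is the derivative at [y = 1] of [ln (a + y * (f (rs s) - a))],
   which is [ln (f s)] as a function of the squared radius. *)
pose q s := (f (rs s) - a) / f (rs s).
have frs s : 1 <= f (rs s) by exact: le_trans (fge s).
have q0 s : 0 <= q s by rewrite divr_ge0 ?subr_ge0// (le_trans ler01).
have q1 s : q s <= 1.
  by rewrite ler_pdivrMr ?(lt_le_trans ltr01)// mul1r gerBl (le_trans ler01).
have f1 s : 1 <= f s.
  by rewrite fE ler_wpDr// mulr_ge0 ?subr_ge0// divr_ge0 ?sqn_ge0// ltW.
have mrs : rmeas (fun s => f (rs s)) by exact: rmeas_rescale.
have mq : rmeas q.
  move=> d T X mX; apply: measurable_funM.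
    by apply: measurable_funB => //; exact: mrs.
  by apply: measurable_inv_ge0; [move=> t; exact: le_trans (frs _)|exact: mrs].
have mL : rmeas (fun s => ln (f (rs s))).
  by move=> d T X mX; apply: (measurableT_comp (@measurable_ln R)); exact: mrs.
have qh l s : 0 < l -> q (smul l s) = q s.
  by move=> l0; rewrite /q /rs rescale_smul.
have Lh l s : 0 < l -> ln (f (rs (smul l s))) = ln (f (rs s)).
  by move=> l0; rewrite /rs rescale_smul.
(* The tangent bound has the term [- q s] on the right; placing it on the left keeps all four terms
   nonnegative. *)
have tangent s : ln (f s) + q s <= ln (f (rs s)) + sqn N.+1 s / m * q s.
  have p0 : 0 < f (rs s) by apply: lt_le_trans (frs s).
  have fs : f s = f (rs s) * (1 + (sqn N.+1 s / m * q s - q s)).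
    rewrite {1}fE /q; move: (sqn N.+1 s / m) => y.
    by field; rewrite gt_eqF.
  have z1 : 0 < 1 + (sqn N.+1 s / m * q s - q s).
    by rewrite -(pmulr_rgt0 _ p0) -fs (lt_le_trans _ (f1 s)).
  rewrite fs lnM ?posrE// -addrA lerD2l -lerBrDr; apply: le_ln1Dx; lra.
set L := fun s => ln (f (rs s)).
have L0 s : 0 <= L s by exact: ln_ge0.
have G0 := gaussN_ge0 v N.+1.
have mG := @rmeas_gaussN v N.+1.
pose Q := ilint N.+1 (fun s => (ballN N.+1 s * q s)%:E).
have mQ : cmeas (fun s => (ballN N.+1 s * q s)%:E).
  by apply: rmeas_cmeas => d T X mX; apply: measurable_funM;
    [exact: rmeas_ballN|exact: mq].
(* Finiteness, from [q <= 1] and the unit mass of the ball weight, is what later allows [Q] to be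
   cancelled from both sides. *)
have Qfin : Q \is a fin_num.
  rewrite ge0_fin_numE; last first.
    by apply: ilint_ge0 => s; rewrite lee_fin mulr_ge0 ?ballN_ge0.
  apply: le_lt_trans (ltry 1); rewrite -(ilint_ballN1 N); apply: le_ilint => //.
  - by apply: rmeas_cmeas; exact: rmeas_ballN.
  - by move=> s; rewrite lee_fin mulr_ge0 ?ballN_ge0.
  - by move=> s; rewrite lee_fin ler_piMr ?ballN_ge0.
pose gr (r : R) := expR (- (r ^+ 2) / (2 * v)) / Num.sqrt (2 * pi * v) ^+ N.+1.
have grE s : gaussN v N.+1 s = gr (nrm N.+1 s) by exact: gaussNE.
have gr0 r : 0 <= gr r by rewrite divr_ge0 ?expR_ge0 ?exprn_ge0 ?sqrtr_ge0.
have mgr : measurable_fun setT gr.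
  apply: measurable_funM => //; apply: (measurableT_comp (@measurable_expR R)).
  by apply: measurable_funM => //; apply: measurableT_comp.
(* Functions of the direction alone have the same mean under the Gaussian and the ball weight. *)
have EG (h : (nat -> R) -> R) : rmeas h -> (forall s, 0 <= h s) ->
    (forall l s, 0 < l -> h (smul l s) = h s) ->
    ilint N.+1 (fun s => (gaussN v N.+1 s * h s)%:E) =
    ilint N.+1 (fun s => (ballN N.+1 s * h s)%:E).
  move=> mh h0 hh; transitivity (ilint N.+1 (fun s => (gr (nrm N.+1 s) * h s)%:E)).
    by apply: eq_ilint => s _; rewrite grE.
  rewrite ilint_polar// -[RHS]mul1e; congr (_ * _)%E.
  by rewrite -(ilint_gaussN1 N.+1 v0); apply: eq_ilint => s _; rewrite grE.
pose C := ilint N.+1 (fun s => (gaussN v N.+1 s * (sqn N.+1 s / m * q s))%:E).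
(* After the radius is decoupled, its factor is the mean of [sqn N.+1 s / m], at most 1 because [m]
   is [N.+1 * v]. *)
have CQ : (C <= Q)%E.
  have mgr2 : measurable_fun setT (fun r => gr r * (r ^+ 2 / m)).
    by apply: measurable_funM => //; apply: measurable_funM.
  have gr20 r : 0 <= gr r * (r ^+ 2 / m)
    by rewrite mulr_ge0 ?divr_ge0 ?sqr_ge0 ?(ltW m0).
  have -> : C = ilint N.+1 (fun s => (gr (nrm N.+1 s) * (nrm N.+1 s ^+ 2 / m) * q
    s)%:E).
    by apply: eq_ilint => s _; rewrite grE sqr_nrm mulrA.
  rewrite (@ilint_polar N q (fun r => gr r * (r ^+ 2 / m)))// -[leRHS]mul1e.
  apply: lee_wpmul2r; first by apply: ilint_ge0 => s;
    rewrite lee_fin mulr_ge0 ?ballN_ge0.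
  have -> : ilint N.+1 (fun s => (gr (nrm N.+1 s) * (nrm N.+1 s ^+ 2 / m))%:E) =
     (ilint N.+1 (fun s => (gaussN v N.+1 s * sqn N.+1 s)%:E) * (m^-1)%:E)%E.
    rewrite -ilintZr.
    - by apply: eq_ilint => s _; rewrite -EFinM grE sqr_nrm mulrA.
    - by apply: rmeas_cmeas => d T X mX; apply: measurable_funM;
      [exact: mG|exact: rmeas_sqn].
    - by move=> s; rewrite lee_fin mulr_ge0 ?sqn_ge0.
    - by rewrite lee_fin invr_ge0 ltW.
  rewrite lee_pdivrMr// mul1e -vm; exact: ilint_gaussN_sqn.
rewrite -(@leeD2rE _ Q)//.
apply: (@le_trans _ _ (ilint N.+1 (fun s => (gaussN v N.+1 s * L s)%:E) + C)%E);
  last first.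
  by apply: leeD => //; rewrite EG.
have mh (h : (nat -> R) -> R) : rmeas h -> cmeas (fun s => (gaussN v N.+1 s * h s)%:E).
  by move=> mh; apply: rmeas_cmeas => d T X mX; apply: measurable_funM;
    [exact: mG|exact: mh].
have mlf : rmeas (fun s => ln (f s)).
  by move=> d T X mX; apply: (measurableT_comp (@measurable_ln R)); exact: mf.
have myq : rmeas (fun s => sqn N.+1 s / m * q s).
  move=> d T X mX; apply: measurable_funM; last exact: mq.
  by apply: measurable_funM => //; exact: rmeas_sqn.
have yq0 s : 0 <= sqn N.+1 s / m * q s.
  by apply: mulr_ge0 => //; rewrite divr_ge0 ?sqn_ge0 ?(ltW m0).
have h0 (h : (nat -> R) -> R) : (forall s, 0 <= h s) ->
    forall s, (0 <= (gaussN v N.+1 s * h s)%:E)%E.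
  by move=> hp s; rewrite lee_fin mulr_ge0.
have lf0 s : 0 <= ln (f s) by exact: ln_ge0.
have [m1 m2 m3 m4] := And4 (mh _ mlf) (mh _ mq) (mh _ mL) (mh _ myq).
have [n1 n2 n3 n4] := And4 (h0 _ lf0) (h0 _ q0) (h0 _ L0) (h0 _ yq0).
rewrite /Q -EG// -(ilintD _ m1 m2 n1 n2) -(ilintD _ m3 m4 n3 n4).
apply: le_ilint.
- by move=> d T X mX; apply: emeasurable_funD; [exact: m1|exact: m2].
- by move=> d T X mX; apply: emeasurable_funD; [exact: m3|exact: m4].
- by move=> s; apply: adde_ge0; [exact: n1|exact: n2].
- by move=> s; rewrite -!EFinD lee_fin -!mulrDr; apply: ler_wpM2l;
  [exact: G0|exact: tangent].
Qed.

End Column.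

(** * Products of independent columns *)

Section Columns.
Context {R : realType}.

Definition mmeas (F : (nat -> nat -> R) -> R) : Prop :=
  forall d (T : measurableType d) (X : nat -> nat -> T -> R),
    (forall j i, measurable_fun setT (X j i)) ->
    measurable_fun setT (fun t => F (fun j i => X j i t)).

(** The cut-off to zero from [N] on matches the arguments that [ilint N] sees, so that [cols_catn]
    holds as an equality of sequences. *)
Definition cols N (s : nat -> R) (j t : nat) : R :=
  if (t < N)%N then s (N * j + t)%N else 0.

Definition colcons (x : nat -> R) (X : nat -> nat -> R) : nat -> nat -> R :=
  fun j => if j is j'.+1 then X j' else x.

Definition upd (X : nat -> nat -> R) (j : nat) (x : nat -> R) : nat -> nat -> R :=
  fun i => if i == j then x else X i.

Definition ballsN N k (s : nat -> R) : R := \prod_(j < k) ballN N (cols N s j).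

Lemma measurable_cols N d (T : measurableType d) (X : nat -> T -> R) :
  (forall i, measurable_fun setT (X i)) ->
  forall j i, measurable_fun setT (fun t => cols N (fun l => X l t) j i).
Proof.
move=> mX j i; rewrite /cols; case: (i < N)%N; last exact: measurable_cst.
exact: mX.
Qed.

Lemma measurable_colcons d (T : measurableType d) (x : nat -> T -> R)
    (X : nat -> nat -> T -> R) :
  (forall i, measurable_fun setT (x i)) ->
  (forall j i, measurable_fun setT (X j i)) ->
  forall j i, measurable_fun setT
    (fun t => colcons (fun l => x l t) (fun l m => X l m t) j i).
Proof. by move=> mx mX [|j] i; [exact: mx|exact: mX]. Qed.

Lemma cols_catn0 N (x s : nat -> R) : (forall i, (N <= i)%N -> x i = 0) ->
  cols N (catn N x s) 0 = x.
Proof.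
move=> x0; apply/funext => t; rewrite /cols /catn muln0 add0n.
by case: (ltnP t N) => // /x0.
Qed.

Lemma cols_catnS N (x s : nat -> R) j : cols N (catn N x s) j.+1 = cols N s j.
Proof.
apply/funext => t; rewrite /cols /catn mulnS -addnA addKn.
by rewrite (ltnNge (N + _)%N) leq_addr.
Qed.

Lemma cols_catn N (x s : nat -> R) : (forall i, (N <= i)%N -> x i = 0) ->
  cols N (catn N x s) = colcons x (cols N s).
Proof.
by move=> x0; apply/funext => -[|j]; [exact: cols_catn0|exact: cols_catnS].
Qed.

Lemma gaussN_catn v N M (x s : nat -> R) :
  gaussN v (N + M) (catn N x s) = gaussN v N x * gaussN v M s.
Proof.
rewrite /gaussN big_split_ord /=; congr (_ * _); apply: eq_bigr => i _.
  by rewrite /catn ltn_ord.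
by rewrite /catn ltnNge leq_addr /= addKn.
Qed.

Lemma ballsN_catn N k (x s : nat -> R) : (forall i, (N <= i)%N -> x i = 0) ->
  ballsN N k.+1 (catn N x s) = ballN N x * ballsN N k s.
Proof.
move=> x0; rewrite /ballsN big_ord_recl cols_catn0//; congr (_ * _).
by apply: eq_bigr => j _; rewrite cols_catnS.
Qed.

Lemma ballsN_ge0 N k s : 0 <= ballsN N k s.
Proof. by apply: prodr_ge0 => j _; exact: ballN_ge0. Qed.

Lemma rmeas_ballsN N k : rmeas (ballsN N k).
Proof.
move=> d T X mX.
apply: (@measurable_prod _ _ _ setT _ _
  (fun j t => ballN N (cols N (fun l => X l t) (nat_of_ord j)))) => j _.
apply: (@rmeas_ballN R N d T (fun i t => cols N (fun l => X l t) j i)).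
exact: measurable_cols.
Qed.

Lemma ilint_ballsN1 D k :
  ilint (D.+1 * k) (fun s => (ballsN D.+1 k s)%:E) = 1%E.
Proof.
elim: k => [|k IH]; first by rewrite muln0 /= /ballsN big_ord0.
rewrite mulnS ilint_catn -(ilint_ballN1 D); apply: eq_ilint => x x0.
rewrite -[RHS]mule1 -IH -ilintZl.
- by apply: eq_ilint => s _; rewrite ballsN_catn.
- by apply: rmeas_cmeas; exact: rmeas_ballsN.
- by move=> s; rewrite lee_fin ballsN_ge0.
- by rewrite lee_fin ballN_ge0.
Qed.

Lemma rescale0 (r : R) N : rescale r N (fun=> 0) = (fun=> 0).
Proof. by apply/funext => i; rewrite /rescale /smul mulr0. Qed.

Lemma cmeas2_mul (a b : (nat -> R) -> R) (F : (nat -> nat -> R) -> R)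
    (phi psi : (nat -> R) -> nat -> R) N :
  rmeas a -> rmeas b -> mmeas F ->
  (forall i, rmeas (phi ^~ i)) -> (forall i, rmeas (psi ^~ i)) ->
  cmeas2 (fun x s => (a x * (b s *
     ln (F (colcons (phi x) (fun j => psi (cols N s j))))))%:E).
Proof.
move=> ma mb mF mphi mpsi d T X Y mX mY; apply/measurable_EFinP.
apply: measurable_funM; first exact: ma.
apply: measurable_funM; first exact: mb.
apply: (measurableT_comp (@measurable_ln R)).
apply: (mF _ _ (fun j i t => colcons (phi (fun l => X l t))
   (fun j => psi (cols N (fun l => Y l t) j)) j i)) => -[|j] i.
  exact: mphi.
apply: (@mpsi i _ _ (fun i t => cols N (fun l => Y l t) j i)).
exact: measurable_cols.
Qed.

Lemma rmeas_mul_ln (b : (nat -> R) -> R) (F : (nat -> nat -> R) -> R)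
    (psi : (nat -> R) -> nat -> R) N :
  rmeas b -> mmeas F -> (forall i, rmeas (psi ^~ i)) ->
  rmeas (fun s => b s * ln (F (fun j => psi (cols N s j)))).
Proof.
move=> mb mF mpsi d T X mX; apply: measurable_funM; first exact: mb.
apply: (measurableT_comp (@measurable_ln R)).
apply: (mF _ _ (fun j i t => psi (cols N (fun l => X l t) j) i)) => j i.
apply: (@mpsi i _ _ (fun i t => cols N (fun l => X l t) j i)).
exact: measurable_cols.
Qed.

Lemma rmeas_rescale_coord (r : R) N i : rmeas (fun s => rescale r N s i).
Proof. by move=> d T X mX; exact: measurable_rescale. Qed.

Lemma rmeas_coord i : rmeas (fun s : nat -> R => s i).
Proof. by move=> d T X mX; exact: mX. Qed.

(** Induction on the number of columns. The hypotheses on [F] are those that survive fixing the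
    first column to any value, so the induction hypothesis handles the others; [gauss_le_ball] then
    treats the first column. *)
Lemma gauss_le_balls D (v m : R) k (F : (nat -> nat -> R) -> R) :
  let N := D.+1 in let rs := rescale (Num.sqrt m) N in
  0 < v -> 0 < m -> N%:R * v = m -> mmeas F ->
  (forall X, 1 <= F X) ->
  (forall X j, (j < k)%N -> F X = F (upd X j (fun=> 0)) +
     sqn N (X j) / m * (F (upd X j (rs (X j))) - F (upd X j (fun=> 0)))) ->
  (forall X j, (j < k)%N -> F (upd X j (fun=> 0)) <= F (upd X j (rs (X j)))) ->
  (ilint (N * k) (fun s => (gaussN v (N * k) s * ln (F (cols N s)))%:E) <=
   ilint (N * k) (fun s => (ballsN N k s * ln (F (fun j => rs (cols N s j))))%:E))%E.
Proof.
move=> N rs v0 m0 vm; elim: k F => [|k IH] F mF F1 FE Fle.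
  rewrite muln0 /= /gaussN /ballsN !big_ord0 !mul1r.
  have c0 : cols N (fun=> 0) = (fun=> fun=> 0).
    by apply/funext => j; apply/funext => t; rewrite /cols if_same.
  by rewrite c0 /rs rescale0.
have lnF0 X : 0 <= ln (F X) by exact: ln_ge0.
(* [B] is the hybrid between the two sides [A] and [C]: first column Gaussian, the others already on
   the sphere. *)
pose A x s := (gaussN v N x * (gaussN v (N * k) s *
  ln (F (colcons x (fun j => cols N s j)))))%:E.
pose B x s := (gaussN v N x * (ballsN N k s *
  ln (F (colcons x (fun j => rs (cols N s j))))))%:E.
pose C x s := (ballN N x * (ballsN N k s *
  ln (F (colcons (rs x) (fun j => rs (cols N s j))))))%:E.
have mA : cmeas2 A.
  by apply: (cmeas2_mul (phi := id) (psi := id)) => //;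
  [exact: rmeas_gaussN|exact: rmeas_gaussN|exact: rmeas_coord|exact: rmeas_coord].
have mB : cmeas2 B.
  by apply: (cmeas2_mul (phi := id)) => //;
  [exact: rmeas_gaussN|exact: rmeas_ballsN|exact: rmeas_coord
    |exact: rmeas_rescale_coord].
have mC : cmeas2 C.
  by apply: (@cmeas2_mul _ _ F rs rs) => //;
  [exact: rmeas_ballN|exact: rmeas_ballsN|exact: rmeas_rescale_coord
    |exact: rmeas_rescale_coord].
have A0 x s : (0 <= A x s)%E by rewrite lee_fin !mulr_ge0 ?gaussN_ge0.
have B0 x s : (0 <= B x s)%E by rewrite lee_fin !mulr_ge0 ?gaussN_ge0 ?ballsN_ge0.
have C0 x s : (0 <= C x s)%E.
  rewrite lee_fin; apply: mulr_ge0; first exact: ballN_ge0.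
  by apply: mulr_ge0; first exact: ballsN_ge0.
rewrite mulnS.
have -> : ilint (N + N * k) (fun s => (gaussN v (N + N * k) s * ln (F (cols N s)))%:E) =
    ilint N (fun x => ilint (N * k) (A x)).
  rewrite ilint_catn; apply: eq_ilint => x x0; apply: eq_ilint => s _.
  by rewrite gaussN_catn cols_catn// /A mulrA.
have -> : ilint (N + N * k) (fun s => (ballsN N k.+1 s *
      ln (F (fun j => rs (cols N s j))))%:E) = ilint N (fun x => ilint (N * k) (C x)).
  rewrite ilint_catn; apply: eq_ilint => x x0; apply: eq_ilint => s _.
  rewrite ballsN_catn// cols_catn// /C mulrA; congr ((_ * ln (F _))%:E).
  by apply/funext => -[|j].
apply: (@le_trans _ _ (ilint N (fun x => ilint (N * k) (B x)))).
  apply: le_ilint; [exact: cmeas_ilint|exact: cmeas_ilint| |].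
    by move=> x; exact: ilint_ge0.
  move=> x; pose F' X := F (colcons x X).
  have mF' : mmeas F'.
    move=> d T X mX.
    apply: (mF _ _ (fun j i t => colcons x (fun l m => X l m t) j i)).
    by apply: (@measurable_colcons _ _ (fun i _ => x i)).
  have G0 : (0 <= (gaussN v N x)%:E)%E by rewrite lee_fin gaussN_ge0.
  have -> : ilint (N * k) (A x) = ((gaussN v N x)%:E *
      ilint (N * k) (fun s => (gaussN v (N * k) s * ln (F' (cols N s)))%:E))%E.
    rewrite -ilintZl//.
      by apply/rmeas_cmeas/(rmeas_mul_ln (psi := id)) => //;
        [exact: rmeas_gaussN|exact: rmeas_coord].
    by move=> s; rewrite lee_fin; apply: mulr_ge0; [exact: gaussN_ge0|exact: lnF0].
  have -> : ilint (N * k) (B x) = ((gaussN v N x)%:E * ilint (N * k)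
      (fun s => (ballsN N k s * ln (F' (fun j => rs (cols N s j))))%:E))%E.
    rewrite -ilintZl//.
      by apply/rmeas_cmeas/rmeas_mul_ln => //;
        [exact: rmeas_ballsN|exact: rmeas_rescale_coord].
    by move=> s; rewrite lee_fin; apply: mulr_ge0; [exact: ballsN_ge0|exact: lnF0].
  have updS X j y : upd (colcons x X) j.+1 y = colcons x (upd X j y).
    by apply/funext => -[|i].
  apply: lee_wpmul2l => //; apply: IH => [//|X|X j jk|X j jk].
  - exact: F1.
  - have := FE (colcons x X) j.+1 jk.
    by rewrite (updS X j (fun=> 0)) (updS X j (rs (X j))).
  - have := Fle (colcons x X) j.+1 jk.
    by rewrite (updS X j (fun=> 0)) (updS X j (rs (X j))).
(* After the swap the first column is integrated innermost, with the projected columns [Y]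
   frozen. *)
rewrite (ilint_swap _ _ mB)// (ilint_swap _ _ mC)//.
apply: le_ilint.
- by apply: cmeas_ilint => //; exact: cmeas2C.
- by apply: cmeas_ilint => //; exact: cmeas2C.
- by move=> s; exact: ilint_ge0.
move=> s; set Y := fun j => rs (cols N s j).
pose f x := F (colcons x Y).
have mf : rmeas f.
  move=> d T X mX; apply: (mF _ _ (fun j i t => colcons (fun l => X l t) Y j i)).
  by apply: (@measurable_colcons _ _ X (fun j i _ => Y j i)).
have b0 : (0 <= (ballsN N k s)%:E)%E by rewrite lee_fin ballsN_ge0.
have upd0 x y : upd (colcons x Y) 0 y = colcons y Y by apply/funext => -[|i].
rewrite (_ : (fun x => B x s) = (fun x => (ballsN N k s)%:E *
    (gaussN v N x * ln (f x))%:E)%E); last first.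
  by apply/funext => x; rewrite -EFinM /B mulrCA.
rewrite (_ : (fun x => C x s) = (fun x => (ballsN N k s)%:E *
    (ballN N x * ln (f (rs x)))%:E)%E); last first.
  by apply/funext => x; rewrite -EFinM /C mulrCA.
have mln (w g : (nat -> R) -> R) : rmeas w -> rmeas g ->
    cmeas (fun x => (w x * ln (g x))%:E).
  move=> mw mg; apply: rmeas_cmeas => d T X mX; apply: measurable_funM; first exact: mw.
  by apply: (measurableT_comp (@measurable_ln R)); exact: mg.
rewrite ilintZl//; last 2 first.
- by apply: mln => //; exact: rmeas_gaussN.
- by move=> x; rewrite lee_fin; apply: mulr_ge0; [exact: gaussN_ge0|exact: lnF0].
rewrite ilintZl//; last 2 first.
- by apply: mln; [exact: rmeas_ballN|exact: rmeas_rescale].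
- by move=> x; rewrite lee_fin; apply: mulr_ge0; [exact: ballN_ge0|exact: lnF0].
apply: lee_wpmul2l => //; apply: gauss_le_ball => // [x||x].
- have := FE (colcons x Y) 0%N isT.
  by rewrite (upd0 x (fun=> 0)) (upd0 x (rs x)).
- exact: F1.
- have := Fle (colcons x Y) 0%N isT.
  by rewrite (upd0 x (fun=> 0)) (upd0 x (rs x)).
Qed.

(** With [m] the mean of [f], integrate the tangent inequality [ln (f s) + 1 <= ln m + f s / m]
    against the weight; the 1 integrates to the total mass and cancels. An infinite mean makes the
    right side infinite. *)
Lemma ilint_ln_le N (w f : (nat -> R) -> R) : rmeas w -> rmeas f ->
  (forall s, 0 <= w s) -> (forall s, 1 <= f s) ->
  ilint N (fun s => (w s)%:E) = 1%E ->
  (ilint N (fun s => (w s * ln (f s))%:E) <= lne (ilint N (fun s => (w s * f s)%:E)))%E.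
Proof.
move=> mw mf w0 f1 w1.
have f0 s : 0 <= f s by exact: le_trans (f1 s).
have mwf : cmeas (fun s => (w s * f s)%:E).
  by apply: rmeas_cmeas => d T X mX; apply: measurable_funM; [exact: mw|exact: mf].
have mwl : cmeas (fun s => (w s * ln (f s))%:E).
  apply: rmeas_cmeas => d T X mX; apply: measurable_funM; first exact: mw.
  by apply: (measurableT_comp (@measurable_ln R)); exact: mf.
have mwE := rmeas_cmeas mw.
(* Besides excluding the value [-oo], this gives [0 <= ln m], so that [ln m] may be taken inside the
   integral as a nonnegative factor. *)
have m1 : (1 <= ilint N (fun s => (w s * f s)%:E))%E.
  by rewrite -w1; apply: le_ilint => [//|//|s|s]; rewrite lee_fin ?ler_peMr.
case E : (ilint N (fun s => (w s * f s)%:E)) m1 => [m| |] //=; last by move=> _;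
  rewrite leey.
rewrite lee_fin => m1; have m0 : 0 < m by exact: lt_le_trans m1.
rewrite -[leRHS]/(lne m%:E) lne_EFin// -(@leeD2rE _ 1%E)//.
rewrite -{1}w1 -ilintD; [|exact: mwl|exact: mwE
  |by move=> s; rewrite lee_fin mulr_ge0 ?ln_ge0|by move=> s; rewrite lee_fin].
have -> : ((ln m)%:E + 1 = (ln m)%:E * ilint N (fun s => (w s)%:E) +
    (m^-1)%:E * ilint N (fun s => (w s * f s)%:E))%E.
  by rewrite w1 E mule1 -EFinM mulVf// gt_eqF.
have lm0 : 0 <= ln m by exact: ln_ge0.
rewrite -ilintZl; [|exact: mwE|by move=> s; rewrite lee_fin|by rewrite lee_fin].
rewrite -ilintZl; [|exact: mwf|by move=> s; rewrite lee_fin mulr_ge0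
  |by rewrite lee_fin invr_ge0 ltW].
rewrite -ilintD; last 4 first.
- by move=> d T X mX; apply: measurable_funeM; exact: mwE.
- by move=> d T X mX; apply: measurable_funeM; exact: mwf.
- by move=> s; rewrite -EFinM lee_fin mulr_ge0.
- by move=> s; rewrite -EFinM lee_fin !mulr_ge0// invr_ge0 ltW.
apply: le_ilint.
- by move=> d T X mX; apply: emeasurable_funD; [exact: mwl|exact: mwE].
- move=> d T X mX; apply: emeasurable_funD; apply: measurable_funeM;
  [exact: mwE|exact: mwf].
- by move=> s; rewrite -EFinD lee_fin addr_ge0 ?mulr_ge0 ?ln_ge0.
move=> s; rewrite -!EFinM -!EFinD lee_fin.
have fs0 : 0 < f s by exact: lt_le_trans (f1 s).
have : ln (f s) + 1 <= ln m + f s / m.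
  have -> : f s = m * (1 + (f s / m - 1)) by rewrite addrC subrK mulrC divfK ?gt_eqF.
  have q0 : 0 < f s / m by rewrite divr_gt0.
  rewrite {1}lnM ?posrE//; last by lra.
  have : ln (1 + (f s / m - 1)) <= f s / m - 1 by apply: le_ln1Dx; lra.
  have -> : m * (1 + (f s / m - 1)) / m = f s / m
    by rewrite mulrC mulKf ?gt_eqF// addrC subrK.
  lra.
move/(ler_wpM2l (w0 s)); rewrite !mulrDr mulr1.
by rewrite (mulrC (ln m)) (mulrCA m^-1) (mulrC m^-1).
Qed.

End Columns.

(** * Gram determinants *)

Section Determinants.

(* Sylvester's identity. *)
Lemma det_1_add_mulmxC (C : comNzRingType) k l (A : 'M[C]_(k, l)) (B : 'M[C]_(l, k)) :
  \det (1%:M + A *m B) = \det (1%:M + B *m A).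
Proof.
have E1 : block_mx 1%:M (- A) B 1%:M *m block_mx 1%:M A 0 1%:M =
    block_mx 1%:M 0 B (1%:M + B *m A).
  rewrite mulmx_block !mul1mx !mulmx1 !mulmx0 addr0 subrr.
  by rewrite addr0 addrC.
have E2 : block_mx 1%:M A 0 1%:M *m block_mx 1%:M (- A) B 1%:M =
    block_mx (1%:M + A *m B) 0 B 1%:M.
  rewrite mulmx_block !mul1mx !mulmx1 !mul0mx !add0r.
  by rewrite addNr.
have := congr1 determinant E1; have := congr1 determinant E2.
rewrite !det_mulmx !det_lblock !det_ublock !det1 !mulr1 !mul1r => <- <-.
by [].
Qed.

(** Only row [j] depends on [x], and it does so affinely. Multilinearity of the determinant in that
    row is applied to [t] written as the combination of 0 and 1 with weights [1 - t] and [t]. *)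
Lemma det_1_add_diag_affine (C : comNzRingType) k (B : 'M[C]_k) (d : C -> 'rV[C]_k)
    (j : 'I_k) (t : C) :
  (forall x i, d x 0 i = if i == j then x else 1) ->
  let f x := \det (1%:M + diag_mx (d x) *m B) in
  f t = f 0 + t * (f 1 - f 0).
Proof.
move=> dE f.
have -> : f 0 + t * (f 1 - f 0) = (1 - t) * f 0 + t * f 1 by ring.
have fE x : f x = \det (\matrix_(i, l) ((i == l)%:R + (if i == j then x else 1) * B i
  l)).
  by congr (\det _); apply/matrixP => i l; rewrite mul_diag_mx !mxE dE.
rewrite !fE; apply: (determinant_multilinear (i0 := j)).
- by apply/rowP => l; rewrite !mxE eqxx; ring.
- by apply/matrixP => i l; rewrite !mxE (eq_sym (lift j i) j) (negbTE (neq_lift _ _)).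
- by apply/matrixP => i l; rewrite !mxE (eq_sym (lift j i) j) (negbTE (neq_lift _ _)).
Qed.

(** By the spectral theorem the determinant is the product of the factors [1 + c * d_i] over the
    eigenvalues [d_i] of the Gram matrix, which are nonnegative. *)
Lemma det_1_add_gram_ge1 (C : numClosedFieldType) n k (K : 'M[C]_(n, k)) (c : C) :
  0 <= c -> 1 <= \det (1%:M + c *: ((map_mx Num.conj K)^T *m K)).
Proof.
move=> c0; set B := _ *m K.
have BE : map_mx Num.conj B^T = B.
  rewrite /B trmx_mul trmxK map_mxM -map_mx_comp map_trmx; congr (_ *m _).
  by apply: map_mx_id => x; exact: conjCK.
have nB : B \is spectral.normalmx by apply/spectral.normalmxP; rewrite BE.
have := spectral.orthomx_spectralP nB.
have uP := spectral.spectral_unitarymx B; have uP1 := spectral.spectral_unit B.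
set P := spectral.spectralmx B in uP uP1 *; set d := spectral.spectral_diag B => E.
(* The diagonalised Gram matrix is again of the form [M] times its adjoint, so each eigenvalue is a
   sum of squared moduli. *)
have dE : diag_mx d = (P *m (map_mx Num.conj K)^T) *m map_mx Num.conj (P *m (map_mx
  Num.conj K)^T)^T.
  have -> : diag_mx d = P *m B *m invmx P.
    by rewrite E !mulmxA mulmxV// mul1mx mulmxK.
  rewrite spectral.invmx_unitary// /B trmx_mul trmxK map_mxM -map_mx_comp.
  rewrite [map_mx (_ \o _) _](map_mx_id (@conjCK _)).
  by rewrite !mulmxA.
have d0 i : 0 <= d ord0 i.
  have := congr1 (fun M : 'M[C]_k => M i i) dE; rewrite [LHS]mxE eqxx mulr1n => ->.
  rewrite [X in 0 <= X]mxE; apply: sumr_ge0 => l _;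
    rewrite [map_mx _ _ _ _]mxE [_^T _ _]mxE.
  by rewrite -normCK exprn_ge0.
have -> : 1%:M + c *: B = invmx P *m (diag_mx (\row_i (1 + c * d ord0 i))) *m P.
  have -> : diag_mx (\row_i (1 + c * d ord0 i)) = 1%:M + c *: diag_mx d.
    by apply/matrixP => i l; rewrite !mxE mulrnDl mulrnAr.
  by rewrite mulmxDr mulmxDl mulmx1 mulVmx// -scalemxAr -scalemxAl -E.
rewrite !det_mulmx mulrAC -det_mulmx mulVmx// det1 mul1r det_diag.
elim/big_ind : _ => // [x y x1 y1|i _].
  by rewrite mulr_ege1.
by rewrite mxE lerDl mulr_ge0.
Qed.

End Determinants.

(** * Dependence of the Gram determinant on one column, and its measurability *)

Section Gram.
Context {R : realType}.
Local Notation C := R[i].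

Definition redet_gram n k (c : R) (K : 'M[C]_(n, k)) : R :=
  redet k (1%:M + (c%:C)%C *: (adjmx n k K *m K)).

Lemma redet_gram_ge1 n k c (K : 'M[C]_(n, k)) : 0 <= c -> 1 <= redet_gram c K.
Proof.
move=> c0; have : 1 <= \det (1%:M + (c%:C)%C *: (adjmx n k K *m K)).
  by apply: det_1_add_gram_ge1; rewrite ler0c.
by rewrite lecE => /andP[_].
Qed.

Definition scale_col k (j : 'I_k) (r : R) : 'rV[C]_k :=
  \row_i (if i == j then r%:C else 1)%C.

(** The diagonal scaling [D] is real, hence self-adjoint, and stands on both sides of the Gram
    matrix. Sylvester's identity gathers the two copies into [D^2] on the left, where [r^2]
    multiplies a single row. *)
Lemma redet_gram_affine n k c (K : 'M[C]_(n, k)) j r :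
  let f r := redet_gram c (K *m diag_mx (scale_col j r)) in
  f r = f 0 + r ^+ 2 * (f 1 - f 0).
Proof.
move=> f; pose B := (c%:C)%C *: (adjmx n k K *m K).
pose d (x : C) : 'rV[C]_k := \row_i (if i == j then x else 1).
pose g x := \det (1%:M + diag_mx (d x) *m B).
have fg x : f x = complex.Re (g (x%:C ^+ 2)%C).
  rewrite /f /redet_gram /redet; congr (complex.Re _).
  pose D := diag_mx (scale_col j x).
  have DE : adjmx n k (K *m D) = D *m adjmx n k K.
    rewrite /adjmx map_mxM trmx_mul; congr (_ *m _).
    apply/matrixP => i l; rewrite !mxE (eq_sym l i).
    case: (eqVneq i l) => [->|_]; last by rewrite !mulr0n raddf0.
    by rewrite !mulr1n; case: ifP => _; [exact: conjc_real|exact: conjC1].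
  have -> : (c%:C)%C *: (adjmx n k (K *m D) *m (K *m D)) = (D *m B) *m D.
    by rewrite DE /B -scalemxAr -scalemxAl !mulmxA.
  rewrite det_1_add_mulmxC mulmxA /g; congr (\det (_ + _ *m _)).
  rewrite /D mulmx_diag; congr diag_mx; apply/rowP => i; rewrite !mxE.
  by case: ifP => _; rewrite ?expr2// mulr1.
have dE x i : d x 0 i = if i == j then x else 1 by rewrite mxE.
have gA t : g t = g 0 + t * (g 1 - g 0) by exact: (det_1_add_diag_affine B t dE).
rewrite !fg gA rmorph0 rmorph1 expr0n expr1n /=.
case: (g 0) (g 1) => [a b] [a' b'].
rewrite -rmorphXn /= !mul0r; ring.
Qed.

(** Turns the lower bound [redet_gram_ge1], valid for every scaling of a column, into monotonicity
    in that scaling. *)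
Lemma slope_ge0 (a b : R) : (forall r, 0 <= a + r ^+ 2 * (b - a)) -> a <= b.
Proof.
move=> ab; rewrite leNgt; apply/negP => lt_ba.
have d0 : 0 < a - b by rewrite subr_gt0.
have a0 : 0 <= a by have := ab 0; rewrite expr0n mul0r addr0.
(* At this radius the affine function takes the value -1. *)
have := ab (Num.sqrt ((a + 1) / (a - b))).
rewrite sqr_sqrtr; last by rewrite divr_ge0 ?(ltW d0)// addr_ge0.
by rewrite -(opprB a b) mulrN divfK ?gt_eqF//; lra.
Qed.

Lemma redet_gram_affine_ge0 n k c (K : 'M[C]_(n, k)) j : 0 <= c ->
  redet_gram c (K *m diag_mx (scale_col j 0)) <=
  redet_gram c (K *m diag_mx (scale_col j 1)).
Proof.
move=> c0; apply: slope_ge0 => r.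
by rewrite -redet_gram_affine; apply: le_trans (redet_gram_ge1 _ c0).
Qed.

(** Column-wise counterpart of [coord_mx]: each column is a separate sequence and can be replaced on
    its own by [upd]. *)
Definition colsmx (cplx : bool) n k (X : nat -> nat -> R) : 'M[C]_(n, k) :=
  \matrix_(i < n, j < k)
    let a := (rdim cplx * i)%N in
    if cplx then Complex (X j a) (X j a.+1) else Complex (X j a) 0.

Lemma coord_mxE cplx n k (s : nat -> R) :
  coord_mx cplx n k s = colsmx cplx n k (cols (rdim cplx * n) s).
Proof.
apply/matrixP => i j; rewrite !mxE /cols mulnDr mulnA.
case: cplx => /=; last by rewrite mul1n mul1n ltn_ord.
have i2 : (2 * i < 2 * n)%N by rewrite ltn_pmul2l// ltn_ord.
have i21 : ((2 * i).+1 < 2 * n)%N.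
  by rewrite -(ltn_pmul2l (isT : 0 < 2)%N) in i2 *; have := ltn_ord i; lia.
by rewrite i2 i21 addnS.
Qed.

Lemma nrm_cols cplx n (s : nat -> R) j : col_norm cplx n s j = nrm (rdim cplx * n)
  (cols (rdim cplx * n) s j).
Proof.
by congr Num.sqrt; apply: eq_bigr => t _; rewrite /cols ltn_ord.
Qed.

Lemma unit_col_mxE cplx n k (s : nat -> R) : unit_col_mx cplx n k s =
  colsmx cplx n k (fun j => rescale 1 (rdim cplx * n) (cols (rdim cplx * n) s j)).
Proof.
apply/matrixP => i j; rewrite [LHS]mxE coord_mxE nrm_cols !mxE /rescale /smul.
rewrite div1r; set z := nrm _ _.
have -> : (z%:C^-1)%C = (z^-1%:C)%C by rewrite -fmorphV.
by clearbody z; case: cplx => /=; simpc; rewrite mulrC// [X in Complex _ X]mulrC.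
Qed.

Lemma colsmx_upd cplx n k (X : nat -> nat -> R) (j : 'I_k) (x y : nat -> R) (r : R) :
  (forall t, (t < rdim cplx * n)%N -> y t = r * x t) ->
  colsmx cplx n k (upd X j y) = colsmx cplx n k (upd X j x) *m diag_mx (scale_col j r).
Proof.
move=> yE; apply/matrixP => i l; rewrite mul_mx_diag !mxE /upd (inj_eq val_inj).
case: eqVneq => _; last by rewrite mulr1.
case: cplx yE => /= yE; last by rewrite !mul1n yE ?mul1n ?ltn_ord//; simpc;
  rewrite mulrC.
rewrite !yE; last 2 first.
- by have := ltn_ord i; lia.
- by have := ltn_ord i; lia.
by simpc; rewrite ![_ * r]mulrC.
Qed.

Lemma upd_id (X : nat -> nat -> R) j : upd X j (X j) = X.
Proof. by apply/funext => i; rewrite /upd; case: eqP => [->|]. Qed.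

Lemma redet_gram_colsE cplx n k c m (X : nat -> nat -> R) j :
  let F X := redet_gram c (colsmx cplx n k X) in
  let N := (rdim cplx * n)%N in
  0 < m -> (j < k)%N -> F X = F (upd X j (fun=> 0)) +
     sqn N (X j) / m * (F (upd X j (rescale (Num.sqrt m) N (X j))) - F (upd X j
       (fun=> 0))).
Proof.
move=> F N m0 jk; pose jo := Ordinal jk; set rs := rescale _ _ _.
(* All three matrices are [K] with column [j] multiplied by 0, by 1, or by the norm of [X j] over
   [sqrt m]. *)
pose K := colsmx cplx n k (upd X jo rs).
have F0 : F (upd X j (fun=> 0)) = redet_gram c (K *m diag_mx (scale_col jo 0)).
  by congr redet_gram; apply: (@colsmx_upd _ _ _ X jo rs) => t _; rewrite mul0r.
have F1 : F (upd X j rs) = redet_gram c (K *m diag_mx (scale_col jo 1)).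
  by congr redet_gram; apply: (@colsmx_upd _ _ _ X jo rs) => t _; rewrite mul1r.
have XE : colsmx cplx n k X =
    K *m diag_mx (scale_col jo (nrm N (X j) / Num.sqrt m)).
  rewrite -[X in colsmx _ _ _ X = _](upd_id X j).
  apply: (@colsmx_upd _ _ _ X jo rs (X j)) => t tN.
  rewrite /rs /rescale /smul; have sm : Num.sqrt m != 0 by rewrite gt_eqF ?sqrtr_gt0.
  (* For a column of zero norm the projection cannot recover the direction, but then all its
     relevant coordinates vanish. *)
  have [n0|n0] := eqVneq (nrm N (X j)) 0.
    have : sqn N (X j) == 0 by rewrite -sqr_nrm n0 expr0n.
    rewrite psumr_eq0; last by move=> i _; exact: sqr_ge0.
    move=> /allP /(_ (Ordinal tN)); rewrite mem_index_enum => /(_ isT).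
    by rewrite /= sqrf_eq0 => /eqP ->; rewrite !mulr0.
  by field; rewrite n0 sm.
rewrite F0 F1 /F XE redet_gram_affine; congr (_ + _ * _).
by rewrite exprMn exprVn sqr_nrm sqr_sqrtr// ltW.
Qed.

Lemma redet_gram_cols_le cplx n k c m (X : nat -> nat -> R) j :
  let F X := redet_gram c (colsmx cplx n k X) in
  let N := (rdim cplx * n)%N in
  0 <= c -> (j < k)%N ->
  F (upd X j (fun=> 0)) <= F (upd X j (rescale (Num.sqrt m) N (X j))).
Proof.
move=> F N c0 jk; pose jo := Ordinal jk; set rs := rescale _ _ _.
pose K := colsmx cplx n k (upd X jo rs).
have -> : F (upd X j (fun=> 0)) = redet_gram c (K *m diag_mx (scale_col jo 0)).
  by congr redet_gram; apply: (@colsmx_upd _ _ _ X jo rs) => t _; rewrite mul0r.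
have -> : F (upd X j rs) = redet_gram c (K *m diag_mx (scale_col jo 1)).
  by congr redet_gram; apply: (@colsmx_upd _ _ _ X jo rs) => t _; rewrite mul1r.
exact: redet_gram_affine_ge0.
Qed.

(** Reconciles the two normalisations: columns of radius [sqrt m] with factor [c / m], and unit
    columns with factor [c]. *)
Lemma redet_gram_scale n k (c m : R) (P : 'M[C]_(n, k)) : 0 < m ->
  redet_gram (c / m) ((Num.sqrt m)%:C%C *: P) = redet_gram c P.
Proof.
move=> m0; rewrite /redet_gram; congr (redet _ (_ + _)).
have -> : adjmx n k ((Num.sqrt m)%:C%C *: P) = (Num.sqrt m)%:C%C *: adjmx n k P.
  apply/matrixP => i j; rewrite !mxE rmorphM; congr (_ * _).
  exact: conjc_real.
rewrite -scalemxAl -scalemxAr !scalerA -!rmorphM.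
by rewrite -mulrA -expr2 sqr_sqrtr ?ltW// divfK ?gt_eqF.
Qed.

Lemma colsmx_rescale cplx n k (r : R) N (X : nat -> nat -> R) :
  colsmx cplx n k (fun j => rescale r N (X j)) =
  r%:C%C *: colsmx cplx n k (fun j => rescale 1 N (X j)).
Proof.
apply/matrixP => i j; rewrite !mxE /rescale /smul.
by rewrite div1r; case: cplx => /=; simpc; rewrite !mulrA.
Qed.

(** Both parts are carried along because the real part of a product, hence of a determinant,
    involves the imaginary parts of its factors. *)
Definition cmfun d (T : measurableType d) (h : T -> C) : Prop :=
  measurable_fun setT (fun t => complex.Re (h t)) /\
  measurable_fun setT (fun t => complex.Im (h t)).

Section ComplexMeasurable.
Context d (T : measurableType d).
Implicit Types h g : T -> C.

Lemma cmfun_cst (a : C) : cmfun (fun _ : T => a).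
Proof. by split; exact: measurable_cst. Qed.

Lemma cmfunD h g : cmfun h -> cmfun g -> cmfun (fun t => h t + g t).
Proof.
move=> [h1 h2] [g1 g2]; split.
  rewrite [X in measurable_fun _ X](_ : _ =
    (fun t => complex.Re (h t) + complex.Re (g t))); first exact: measurable_funD.
  by apply/funext => t; case: (h t) (g t) => [? ?] [? ?].
rewrite [X in measurable_fun _ X](_ : _ =
  (fun t => complex.Im (h t) + complex.Im (g t))); first exact: measurable_funD.
by apply/funext => t; case: (h t) (g t) => [? ?] [? ?].
Qed.

Lemma cmfunM h g : cmfun h -> cmfun g -> cmfun (fun t => h t * g t).
Proof.
move=> [h1 h2] [g1 g2]; split.
  rewrite [X in measurable_fun _ X](_ : _ = (fun t =>
      complex.Re (h t) * complex.Re (g t) - complex.Im (h t) * complex.Im (g t))).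
    by apply: measurable_funB; exact: measurable_funM.
  by apply/funext => t; case: (h t) (g t) => [? ?] [? ?].
rewrite [X in measurable_fun _ X](_ : _ = (fun t =>
    complex.Re (h t) * complex.Im (g t) + complex.Im (h t) * complex.Re (g t))).
  by apply: measurable_funD; exact: measurable_funM.
by apply/funext => t; case: (h t) (g t) => [? ?] [? ?].
Qed.

Lemma cmfun_conj h : cmfun h -> cmfun (fun t => Num.conj (h t)).
Proof.
move=> [h1 h2]; split.
  rewrite [X in measurable_fun _ X](_ : _ = (fun t => complex.Re (h t)))//.
  by apply/funext => t; case: (h t).
rewrite [X in measurable_fun _ X](_ : _ = (fun t => - complex.Im (h t))).
  exact: measurableT_comp.
by apply/funext => t; case: (h t).
Qed.

Lemma cmfun_sum (I : Type) (s : seq I) (h : I -> T -> C) :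
  (forall i, cmfun (h i)) -> cmfun (fun t => \sum_(i <- s) h i t).
Proof.
move=> mh; elim: s => [|i s IH].
  by under eq_fun do rewrite big_nil; exact: cmfun_cst.
by under eq_fun do rewrite big_cons; exact: cmfunD.
Qed.

Lemma cmfun_prod (I : Type) (s : seq I) (h : I -> T -> C) :
  (forall i, cmfun (h i)) -> cmfun (fun t => \prod_(i <- s) h i t).
Proof.
move=> mh; elim: s => [|i s IH].
  by under eq_fun do rewrite big_nil; exact: cmfun_cst.
by under eq_fun do rewrite big_cons; exact: cmfunM.
Qed.

Lemma cmfun_det k (A : T -> 'M[C]_k) : (forall i j, cmfun (fun t => A t i j)) ->
  cmfun (fun t => \det (A t)).
Proof.
move=> mA; apply: cmfun_sum => s; apply: cmfunM; first exact: cmfun_cst.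
exact: cmfun_prod.
Qed.

Lemma cmfun_mulmx k l m (A : T -> 'M[C]_(k, l)) (B : T -> 'M[C]_(l, m)) :
  (forall i j, cmfun (fun t => A t i j)) -> (forall i j, cmfun (fun t => B t i j)) ->
  forall i j, cmfun (fun t => (A t *m B t) i j).
Proof.
move=> mA mB i j; under eq_fun do rewrite mxE.
by apply: cmfun_sum => l'; exact: cmfunM.
Qed.

End ComplexMeasurable.

Lemma mmeas_redet_gram cplx n k c :
  mmeas (fun X => redet_gram c (colsmx cplx n k X)).
Proof.
move=> d T X mX.
have mK i j : cmfun (fun t => colsmx cplx n k (fun j i => X j i t) i j).
  by under eq_fun do rewrite mxE; case: cplx => /=; split => //=; exact: mX.
suff [] : cmfun (fun t => \det (1%:M + (c%:C)%C *:
    (adjmx n k (colsmx cplx n k (fun j i => X j i t)) *m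
     colsmx cplx n k (fun j i => X j i t)))) by [].
apply: cmfun_det => i j; under eq_fun do rewrite mxE [X in _ + X]mxE.
apply: cmfunD; first exact: cmfun_cst.
apply: cmfunM; first exact: cmfun_cst.
apply: cmfun_mulmx => // i' j'; under eq_fun do rewrite mxE mxE.
exact: cmfun_conj.
Qed.

End Gram.

Unset Implicit Arguments.

(* cplx = false : L = R ; cplx = true : L = C *)
Theorem theorem3 (R : realType) (cplx : bool) (n k : nat) (c : R) :
  (1 <= n)%N -> (1 <= k)%N -> 0 < c ->
  (gauss_expect cplx n k
     (fun H => logdet k (1%:M + ((c / n%:R)%:C)%C *: (adjmx n k H *m H)))
   <= sphere_expect cplx n k
     (fun P => logdet k (1%:M + (c%:C)%C *: (adjmx n k P *m P))))%E /\
  (sphere_expect cplx n k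
     (fun P => logdet k (1%:M + (c%:C)%C *: (adjmx n k P *m P)))
   <= lne (sphere_expect cplx n k
     (fun P => redet k (1%:M + (c%:C)%C *: (adjmx n k P *m P)))))%E.
Proof.
move=> n1 _ c0; pose N := (rdim cplx * n)%N.
have n0 : 0 < n%:R :> R by rewrite ltr0n.
have cn0 : 0 <= c / n%:R by rewrite divr_ge0 ?ltW.
(* A single [F] must serve both sides, so the sphere columns are given radius [sqrt n], the root
   mean square norm of a Gaussian column. *)
pose F X := redet_gram (c / n%:R) (colsmx cplx n k X).
pose rs := rescale (Num.sqrt (n%:R : R)) N.
have sphereE s : redet_gram c (unit_col_mx cplx n k s) = F (fun j => rs (cols N s j)).
  by rewrite unit_col_mxE -(redet_gram_scale _ _ n0) -colsmx_rescale.
have weightE s : \prod_(j < k) ((if col_norm cplx n s j <= 1 then 1 else 0)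
    / fine (ball_vol (rdim cplx * n))) = ballsN N k s.
  by rewrite /ballsN /ballN /ball1; apply: eq_bigr => j _; rewrite nrm_cols.
have [D DE] : exists D, N = D.+1.
  by exists N.-1; rewrite prednK// muln_gt0 n1 andbT; case: (cplx).
have r0 : (rdim cplx)%:R != 0 :> R by rewrite pnatr_eq0; case: (cplx).
have gaussE : gauss_expect cplx n k
    (fun H => logdet k (1%:M + ((c / n%:R)%:C)%C *: (adjmx n k H *m H))) =
    ilint (N * k) (fun s => (gaussN (rdim cplx)%:R^-1 (N * k) s * ln (F (cols N s)))%:E).
  by apply: eq_ilint => s _; rewrite coord_mxE.
have ball_lnE : sphere_expect cplx n k
    (fun P => logdet k (1%:M + (c%:C)%C *: (adjmx n k P *m P))) =
    ilint (N * k) (fun s => (ballsN N k s * ln (F (fun j => rs (cols N s j))))%:E).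
  by apply: eq_ilint => s _; rewrite weightE -sphereE.
have ballE : sphere_expect cplx n k
    (fun P => redet k (1%:M + (c%:C)%C *: (adjmx n k P *m P))) =
    ilint (N * k) (fun s => (ballsN N k s * F (fun j => rs (cols N s j)))%:E).
  by apply: eq_ilint => s _; rewrite weightE -sphereE.
rewrite gaussE ball_lnE ballE; split.
  (* With variance [1 / rdim] per real coordinate, the mean squared norm [N * v] equals [n] for both
     fields. *)
  have H := @gauss_le_balls R D (rdim cplx)%:R^-1 n%:R k F.
  rewrite -DE in H; refine (H _ n0 _ _ _ _ _).
  - by rewrite invr_gt0 ltr0n; case: (cplx).
  - by rewrite /N natrM mulrAC mulfV ?mul1r.
  - exact: mmeas_redet_gram.
  - by move=> X; exact: redet_gram_ge1.
  - by move=> X j jk; exact: redet_gram_colsE.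
  - by move=> X j jk; exact: redet_gram_cols_le.
apply: ilint_ln_le.
- exact: rmeas_ballsN.
- move=> d T X mX.
  apply: (@mmeas_redet_gram R cplx n k _ _ T (fun j i t => rs (cols N (fun l => X l t) j) i)).
  move=> j; apply: (@measurable_rescale R _ _ _ T (fun i t => cols N (fun l => X l t) j i)).
  exact: measurable_cols.
- by move=> s; exact: ballsN_ge0.
- by move=> s; exact: redet_gram_ge1.
- by rewrite -/N DE; exact: ilint_ballsN1.
Qed.
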